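(* Let $S$ be a finite commutative semigroup. If $S^2\neq S$, then $\theta_S=0$. Suppose $S^2=S$. If, for some $e\in E(S)$ and $\chi\in\widehat{G_e}$, the monoid $(\widetilde H_e^0/I_\chi)/G_e$ does not have a unique annihilating element (i.e., $s_\chi$ does not exist), then $\theta_S=0$. Otherwise, $s_\chi$ exists for every $e\in E(S)$ and $\chi\in\widehat{G_e}$, and $$\theta_S=\pm\prod_{e\in E(S)}\prod_{\chi\in\widehat{G_e}}\left(\prod_{s\in T_{e,\chi}}\frac{|G_es|}{|G_e|}\right)\det A(\chi)\cdot\left(\sum_{g\in G_e}\overline{\chi(g)}\sum_{t\leq gs_\chi}\mu_S(t,gs_\chi)x_t\right)^{|T_{e,\chi}|},$$ where $\mu_S$ is the Möbius function of $S$ with respect to the partial order $s\leq t$ if $s\in tE(S)$. (Notation as in the context.)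
   Context: $\theta_S\in\mathbb C[x_s\mid s\in S]$ is the semigroup determinant: the determinant of the $S\times S$ matrix with $(s,t)$-entry $x_{st}$. $E(S)$ is the set of idempotents of $S$, ordered by $e\le f$ if $ef=e$. The Möbius function $\mu_S$ is the inverse of the $S\times S$ zeta matrix $\zeta_S(x,y)=1$ if $x\le y$, $0$ otherwise. The symbol $\pm$ means equality up to a sign. Assume $S^2=S$. For $s\in S$, $s^+$ is the minimum idempotent $e\in E(S)$ with $se=s$ (it exists). For $e\in E(S)$, put $\widetilde H_e=\{s\in S\mid s^+=e\}$. The monoid $\widetilde H_e^0=\widetilde H_e\cup\{z\}$ has identity $e$, zero $z$ and product of $a,b\in\widetilde H_e$ equal to $ab$ if $ab\in\widetilde H_e$ and $z$ otherwise. $G_e\subseteq\widetilde H_e$ is the group of units of the monoid $eSe$; it is also the group of units of $\widetilde H_e^0$, all of whose nonunits are nilpotent. $\widehat{G_e}$ is the group of characters $\chi\colon G_e\to\mathbb C^\times$. For each $e\in E(S)$, fix a set $T_e$ of representatives of the orbits of $G_e$ on $\widetilde H_e$, with $e\in T_e$. For $\chi\in\widehat{G_e}$, $T_{e,\chi}$ is the set of elements of $T_e$ whose stabilizer in $G_e$ is contained in $\ker\chi$. $I_\chi$ is the set of elements of $\widetilde H_e^0$ whose stabilizer in $G_e$ is not contained in $\ker\chi$; it is empty if $\chi$ is trivial and otherwise a proper ideal containing $z$. $\widetilde H_e^0/I_\chi$ is the Rees quotient collapsing $I_\chi$ to zero (it is $\widetilde H_e^0$ itself if $I_\chi=\emptyset$),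 and $(\widetilde H_e^0/I_\chi)/G_e$ is its quotient monoid of $G_e$-orbits, with product $G_em\cdot G_em'=G_emm'$. All nonidentity elements of this monoid are nilpotent; a nonzero element $m$ of it is annihilating if $mn$ is zero for every nonidentity element $n$. If there is a unique annihilating element, $s_\chi\in T_{e,\chi}$ denotes the representative of the corresponding orbit, and $A(\chi)$ is the $T_{e,\chi}\times T_{e,\chi}$-matrix with $A(\chi)_{s,t}=\chi(g)$ if $st=gs_\chi$ with $g\in G_e$ (independent of the choice of $g$), and $A(\chi)_{s,t}=0$ otherwise. *)

(* Defs.v *)
From HB Require Import structures.
From mathcomp Require Export all_boot all_order all_algebra.
From mathcomp Require Export complex mpoly.
From mathcomp Require Export boolp classical_sets fsbigop reals.

Set Implicit Arguments.
Unset Strict Implicit.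
Unset Printing Implicit Defensive.

Import Order.TTheory GRing.Theory Num.Theory.
Local Open Scope ring_scope.

(* The finite commutative semigroup is a finType S with a multiplication mul;
   associativity and commutativity are hypotheses of the theorem. *)
Section Semigroup.
Context {S : finType} (mul : S -> S -> S).

Definition square : {set S} := [set mul s t | s in [set: S], t in [set: S]].

Definition idem : {set S} := [set e | mul e e == e].

(* s <= t iff s belongs to t E(S) *)
Definition sle (s t : S) : bool := [exists f in idem, s == mul t f].

(* On E(S), e <= f iff f e = e; is_plus s e says that e is the minimum of the
   idempotents fixing s, i.e. that s^+ exists and is equal to e. *)
Definition is_plus (s e : S) : bool :=
  [&& e \in idem, mul s e == s &
      [forall f in idem, (mul s f == s) ==> (mul f e == e)]].

Definition Htilde (e : S) : {set S} := [set s | is_plus s e].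

Definition local_monoid (e : S) : {set S} :=
  [set mul (mul e s) e | s in [set: S]].

Definition unitsG (e : S) : {set S} :=
  [set g in local_monoid e |
     [exists h in local_monoid e, (mul g h == e) && (mul h g == e)]].

Definition Gorbit (e s : S) : {set S} := [set mul g s | g in unitsG e].

Definition is_reps (e : S) (Tr : {set S}) : Prop :=
  is_transversal Tr [set Gorbit e s | s in Htilde e] (Htilde e) /\ e \in Tr.

(* The monoid Htilde e together with a new zero z: z is None, so the
   construction stays inside option S. *)
Definition H0 (e : S) : {set option S} :=
  None |: [set Some s | s in Htilde e].

Definition mulH (e : S) (a b : option S) : option S :=
  if (a, b) is (Some s, Some t) then
    if mul s t \in Htilde e then Some (mul s t) else None
  else None.

Definition stabG (e : S) (m : option S) : {set S} :=
  [set g in unitsG e | mulH e (Some g) m == m].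

Section Character.
Context {C : numClosedFieldType} (e : S) (chi : {ffun S -> C}).

(* A character G_e -> C^* is encoded as a function on S vanishing outside G_e,
   so that Leibniz equality is equality of characters. *)
Definition is_char : Prop :=
  [/\ {in unitsG e, forall g, chi g != 0},
      {in unitsG e &, forall g h, chi (mul g h) = chi g * chi h}
    & forall s, s \notin unitsG e -> chi s = 0].

Definition kerG : {set S} := [set g in unitsG e | chi g == 1].

Definition Ichi : {set option S} :=
  [set m in H0 e | ~~ (stabG e m \subset kerG)].

Definition Tchi (Tr : {set S}) : {set S} :=
  [set s in Tr | stabG e (Some s) \subset kerG].

(* The Rees quotient H0 e / Ichi is represented by the elements outside Ichi
   and the zero None; when Ichi is empty this is H0 e itself. *)
Definition rees : {set option S} := None |: (H0 e :\: Ichi).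

Definition mulR (a b : option S) : option S :=
  if mulH e a b \in Ichi then None else mulH e a b.

Definition rorbit (m : option S) : {set option S} :=
  [set mulR (Some g) m | g in unitsG e].

Definition orbmon : {set {set option S}} := [set rorbit m | m in rees].

(* The product of two orbits is their product as subsets: the product set of
   G_e m and G_e m' is G_e (m m'). *)
Definition mulO (X Y : {set option S}) : {set option S} :=
  [set mulR a b | a in X, b in Y].

Definition annihilating (X : {set option S}) : bool :=
  [&& X \in orbmon, X != rorbit None &
      [forall Y in orbmon,
         (Y != rorbit (Some e)) ==> (mulO X Y == rorbit None)]].

Definition is_schi (Tr : {set S}) (sc : S) : Prop :=
  sc \in Tchi Tr /\ annihilating (rorbit (Some sc)).

Definition Aentry (sc s t : S) : C :=
  if [pick g in unitsG e | mul s t == mul g sc] is Some g then chi g else 0.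

Definition Amatrix (Tr : {set S}) (sc : S) : 'M[C]_#|Tchi Tr| :=
  \matrix_(i, j) Aentry sc (enum_val i) (enum_val j).

End Character.

Definition charG (C : numClosedFieldType) (e : S) : set {ffun S -> C} :=
  is_char e.

Definition zeta (C : numClosedFieldType) : 'M[C]_#|S| :=
  \matrix_(i, j) (sle (enum_val i) (enum_val j))%:R.

Definition moebius (C : numClosedFieldType) (s t : S) : C :=
  invmx (zeta C) (enum_rank s) (enum_rank t).

(* C[x_s | s in S] is {mpoly C[#|S|]}, with x_s the variable of index
   enum_rank s. *)
Definition xvar (C : numClosedFieldType) (s : S) : {mpoly C[#|S|]} :=
  'X_(enum_rank s).

Definition sgdet (C : numClosedFieldType) : {mpoly C[#|S|]} :=
  \det (\matrix_(i < #|S|, j < #|S|)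
          xvar C (mul (enum_val i) (enum_val j))).

End Semigroup.

(* Main.v *)
Require Import Defs.
From mathcomp Require Import all_boot all_order all_algebra.
From mathcomp Require Import fingroup perm separable cyclotomic.
From mathcomp Require Import complex mpoly.
From mathcomp Require Import boolp classical_sets fsbigop reals.

Set Implicit Arguments.
Unset Strict Implicit.
Unset Printing Implicit Defensive.

Import Order.TTheory GRing.Theory Num.Theory.
Local Open Scope ring_scope.

(* The matrix (x_{st}) is the Gram matrix of the form (a, b) |-> x(ab) on the
   semigroup algebra, where x is the generic functional s |-> x_s.  In the basis
   of the elements sum_(t <= s) mu(t, s) t, whose transition matrix is
   unitriangular, the algebra splits as the product over the idempotents e of
   the contracted algebras of H_e^0, so the determinant is a product of blocks.

   In the block of e, the vectors s e_chi, for chi a character of G_e and s in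
   T_{e,chi}, form a basis in which the form splits further over chi.  The
   orthogonality relations give P^* P = diag |G_e s| for the transition matrix
   P; as conjugation permutes the characters, det P is conj(det P) up to sign,
   hence (det P)^2 is the product of the |G_e s| up to sign.

   In the block of (e, chi) the algebra is local.  If a functional f is
   nondegenerate, any other functional is f' = f(c -), and multiplication by c
   is triangular with constant diagonal c_1.  At an annihilating element u one
   has f'(u) = c_1 f(u), so det(f') f(u)^n = det(f) f'(u)^n with n = |T_{e,chi}|.
   Comparing f with the coordinate along s_chi, whose matrix is A(chi), gives
   the formula.  Two annihilating elements give two rows of the matrix supported
   in the same column, so that the determinant vanishes. *)

(** * Determinants indexed by sequences *)

Section SeqDet.
Variable R : comNzRingType.

(** Rows and columns are indexed by one sequence, so that bases can be concatenated, mapped and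
    reordered without casts between ordinals. *)
Definition sdet (I : Type) (s : seq I) (f : I -> I -> R) : R :=
  \det (\matrix_(i < size s, j < size s)
          f (tnth (in_tuple s) i) (tnth (in_tuple s) j)).

Lemma det_cast n m (E : n = m) (A : 'M[R]_m) :
  \det (\matrix_(i, j) A (cast_ord E i) (cast_ord E j)) = \det A.
Proof.
by case: m / E A => A; congr determinant; apply/matrixP=> i j;
  rewrite mxE !cast_ord_id.
Qed.

Lemma det_tuple n (I : Type) (t : n.-tuple I) (f : I -> I -> R) :
  \det (\matrix_(i < n, j < n) f (tnth t i) (tnth t j)) = sdet t f.
Proof.
rewrite /sdet -(det_cast (size_tuple t)); congr determinant.
apply/matrixP => i j; rewrite !mxE.
by rewrite !(tnth_nth (tnth_default t (cast_ord (size_tuple t) i))).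
Qed.

Lemma sdet_map (I J : Type) (h : J -> I) s f :
  sdet (map h s) f = sdet s (fun x y => f (h x) (h y)).
Proof.
rewrite /sdet -(det_cast (esym (size_map h s))); congr determinant.
apply/matrixP => i j; rewrite !mxE.
have Ei (k : 'I_(size s)) :
    tnth (in_tuple (map h s)) (cast_ord (esym (size_map h s)) k)
    = h (tnth (in_tuple s) k).
  have x := tnth (in_tuple s) k.
  by rewrite (tnth_nth (h x)) /= (nth_map x) // (tnth_nth x).
by rewrite !Ei.
Qed.

Lemma sdet_enum (S : finType) (A : {pred S}) (f : S -> S -> R) :
  \det (\matrix_(i < #|A|, j < #|A|) f (enum_val i) (enum_val j))
  = sdet (enum A) f.
Proof.
rewrite -(det_tuple (enum_tuple A)); congr determinant.
apply/matrixP => i j; rewrite !mxE.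
by rewrite !(tnth_nth (enum_default i)) /= !(enum_val_nth (enum_default i)).
Qed.

Lemma eq_sdet (I : eqType) (s : seq I) f g :
  {in s &, f =2 g} -> sdet s f = sdet s g.
Proof.
move=> fg; congr determinant; apply/matrixP => i j; rewrite !mxE.
by apply: fg; apply: (mem_tnth _ (in_tuple s)).
Qed.

Lemma sdet_tr (I : Type) (s : seq I) f :
  sdet s (fun x y => f y x) = sdet s f.
Proof.
by rewrite /sdet -det_tr; congr determinant; apply/matrixP=> i j; rewrite !mxE.
Qed.

(** The same permutation acts on rows and columns, so its sign occurs twice. *)
Lemma sdet_perm (I : eqType) (s t : seq I) f :
  perm_eq s t -> sdet s f = sdet t f.
Proof.
move=> st; have st' : perm_eq s (in_tuple t) by [].
have [p Ep] := tuple_permP st'.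
rewrite Ep -(det_tuple [tuple tnth (in_tuple t) (p i) | i < size t]) /sdet.
set A := \matrix_(_, _) _.
set B := \matrix_(_ < size t, _ < size t) _.
have -> : A = row_perm p (col_perm p B).
  by apply/matrixP => i j; rewrite !mxE !tnth_mktuple.
rewrite row_permE col_permE !det_mulmx !det_perm odd_permV mulrCA.
by rewrite -signr_addb addbb mulr1.
Qed.

(** The sign depends only on [c] and [s], whence the order of the quantifiers. *)
Lemma sdet_permcol (I : eqType) (s : seq I) (c : I -> I) :
  perm_eq (map c s) s ->
  exists b : bool, forall f,
    sdet s (fun x y => f x (c y)) = (-1) ^+ b * sdet s f.
Proof.
move=> st; have st' : perm_eq (map c s) (in_tuple s) by [].
have [p Ep] := tuple_permP st'.
exists (odd_perm p) => f.
have Ec i : c (tnth (in_tuple s) i) = tnth (in_tuple s) (p i).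
  have x := tnth (in_tuple s) i.
  rewrite -(tnth_mktuple (fun i => tnth (in_tuple s) (p i))).
  rewrite [RHS](tnth_nth (c x)) -Ep (nth_map x) ?(tnth_nth x) //.
rewrite /sdet; set A := (X in _ = _ * \det X).
rewrite -(odd_permV p) -det_perm mulrC -det_mulmx -col_permE.
by congr determinant; apply/matrixP => i j; rewrite !mxE Ec.
Qed.

Lemma sdet_scale (I : Type) (s : seq I) a f :
  sdet s (fun x y => a * f x y) = a ^+ size s * sdet s f.
Proof.
by rewrite /sdet -detZ; congr determinant; apply/matrixP => i j; rewrite !mxE.
Qed.

Lemma sdet_mul (I : eqType) (s : seq I) (F G : I -> I -> R) :
  sdet s (fun x y => \sum_(z <- s) F x z * G z y) = sdet s F * sdet s G.
Proof.
rewrite /sdet -det_mulmx; congr determinant; apply/matrixP => i j.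
rewrite !mxE (big_tnth _ _ s) /=.
by apply: eq_bigr => k _; rewrite !mxE.
Qed.

Lemma sdet_cat (I : eqType) (s t : seq I) f :
  (forall x y, x \in s -> y \in t -> f x y = 0) ->
  sdet (s ++ t) f = sdet s f * sdet t f.
Proof.
move=> f0; rewrite /sdet -(det_cast (esym (size_cat s t))).
set B := \matrix_(i, j) _; rewrite -(submxK B).
have El k : tnth (in_tuple (s ++ t)) (cast_ord (esym (size_cat s t)) (lshift _ k))
    = tnth (in_tuple s) k.
  have x := tnth (in_tuple s) k.
  by rewrite !(tnth_nth x) /= nth_cat ltn_ord.
have Er k : tnth (in_tuple (s ++ t)) (cast_ord (esym (size_cat s t)) (rshift _ k))
    = tnth (in_tuple t) k.
  have x := tnth (in_tuple t) k.
  by rewrite !(tnth_nth x) /= nth_cat ltnNge leq_addr /= addKn.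
have -> : ursubmx B = 0.
  apply/matrixP => i j; rewrite !mxE El Er.
  by apply: f0; apply: (mem_tnth _ (in_tuple _)).
rewrite det_lblock; congr (_ * _); congr determinant; apply/matrixP => i j;
  by rewrite !mxE ?El ?Er.
Qed.

Lemma sdet_nil (I : Type) (f : I -> I -> R) : sdet [::] f = 1.
Proof. exact: det_mx00. Qed.

Lemma sdet_flatten (I K : eqType) (ks : seq K) (F : K -> seq I) f :
  uniq ks ->
  (forall k l x y, k \in ks -> l \in ks -> k != l ->
     x \in F k -> y \in F l -> f x y = 0) ->
  sdet (flatten (map F ks)) f = \prod_(k <- ks) sdet (F k) f.
Proof.
elim: ks => [|k ks IH] /=; first by rewrite sdet_nil big_nil.
case/andP=> kNks uks f0; rewrite big_cons sdet_cat.
  rewrite IH // => l m x y lks mks; apply: f0; rewrite inE ?lks ?mks ?orbT //.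
move=> x y xk /flattenP [_ /mapP [l lks ->] yl].
apply: (f0 k l) => //; rewrite ?inE ?eqxx ?lks ?orbT //.
by apply: contraNneq kNks => ->.
Qed.

(** If all entries [A i (p i)] of a Leibniz term are nonzero, then [r i (p i)] for all [i];
    following the cycle of [i] gives [r (p i) i], and antisymmetry forces [p = 1]. No linear
    extension of [r] has to be chosen. *)
Lemma det_triangular n (r : rel 'I_n) (A : 'M[R]_n) :
  transitive r -> antisymmetric r ->
  (forall i j, A i j != 0 -> r i j) -> \det A = \prod_i A i i.
Proof.
move=> rT rA Ar; rewrite /determinant (bigD1 1%g) //= [X in _ + X]big1.
  by rewrite addr0 odd_perm1 mul1r; apply: eq_bigr => i _; rewrite perm1.
move=> p pN1.
have [/forallP Ap|] := boolP [forall i, A i (p i) != 0]; last first.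
  by case/forallPn=> i; rewrite negbK => /eqP A0; rewrite (bigD1 i) //= A0
    mul0r mulr0.
have rp i : r i (p i) by exact: Ar.
have rk k i : r i ((p ^+ k.+1)%g i).
  elim: k => [|k IH]; first by rewrite expg1.
  by apply: rT IH _; rewrite [in X in r _ X]expgSr permM.
case/eqP: pN1; apply/permP => i; rewrite perm1.
have := expg_order p; have := order_gt0 p; case: #[p]%g => [|[|k]] // _ pk.
  by rewrite -(expg1 p) pk perm1.
apply: rA; rewrite (rp i : r i (p i)) andbT.
by have := rk k (p i); rewrite -permM -expgS pk perm1.
Qed.

Lemma sdet_triangular (I : eqType) (s : seq I) (r : rel I) f :
  uniq s -> {in s & &, transitive r} -> {in s &, antisymmetric r} ->
  {in s &, forall x y, f x y != 0 -> r x y} ->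
  sdet s f = \prod_(x <- s) f x x.
Proof.
move=> us rT rA fr.
have ms i : tnth (in_tuple s) i \in s by apply: (mem_tnth _ (in_tuple s)).
rewrite /sdet (det_triangular (r := fun i j => r (tnth (in_tuple s) i)
  (tnth (in_tuple s) j))).
- by rewrite (big_tnth _ _ s) /=; apply: eq_bigr => i _; rewrite mxE.
- by move=> j i k; apply: rT.
- move=> i j /rA E; apply: (tuple_uniqP (in_tuple s) us).
  by apply: E; rewrite ms.
- by move=> i j; rewrite mxE; apply: fr.
Qed.

Lemma sdet_diag (I : eqType) (s : seq I) (f : I -> I -> R) :
  uniq s -> {in s &, forall x y, x != y -> f x y = 0} ->
  sdet s f = \prod_(x <- s) f x x.
Proof.
move=> us f0; apply: (sdet_triangular (r := fun x y => x == y)) => //.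
- by move=> y x z _ _ _ /eqP ->.
- by move=> x y _ _ /andP [/eqP].
- by move=> x y xs ys; apply: contraR => /f0 ->.
Qed.

(** A permutation sends at most one of the rows [u] and [v] to the column [e]; the other row puts a
    zero factor into the Leibniz term. *)
Lemma sdet_rows0 (I : eqType) (s : seq I) (f : I -> I -> R) u v e :
  uniq s -> u \in s -> v \in s -> u != v ->
  (forall t, t \in s -> t != e -> f u t = 0 /\ f v t = 0) -> sdet s f = 0.
Proof.
move=> us /(tnthP (in_tuple s)) [i ->] /(tnthP (in_tuple s)) [j ->] ij f0.
rewrite /sdet /determinant big1 // => p _.
have [Ei|Ni] := eqVneq (tnth (in_tuple s) (p i)) e.
  rewrite (bigD1 j) //= mxE (f0 _ _ _).2 ?mul0r ?mulr0 //.
    exact: (mem_tnth _ (in_tuple s)).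
  rewrite -Ei; apply: contraNneq ij => /(tuple_uniqP (in_tuple s) us).
  by move=> /perm_inj ->.
rewrite (bigD1 i) //= mxE (f0 _ _ _).1 ?mul0r ?mulr0 //.
exact: (mem_tnth _ (in_tuple s)).
Qed.

Definition seq_fun (I : eqType) (s : seq I) (w : 'rV[R]_(size s)) (x : I) : R :=
  if insub (index x s) is Some i then w 0 i else 0.

Lemma seq_funE (I : eqType) (s : seq I) (w : 'rV[R]_(size s)) i :
  uniq s -> seq_fun w (tnth (in_tuple s) i) = w 0 i.
Proof.
move=> us; rewrite /seq_fun; set x := tnth _ i.
have E : index x s = i by rewrite /x (tnth_nth x) /= index_uniq.
by rewrite E valK.
Qed.

(** Cramer's rule: the adjugate replaces the inverse, at the cost of the factor [sdet s f] on the
    right. *)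
Lemma sdet_adj (I : eqType) (s : seq I) (f : I -> I -> R) (v : I -> R) :
  uniq s -> exists c : I -> R,
  {in s, forall y, \sum_(x <- s) c x * f x y = sdet s f * v y}.
Proof.
move=> us; pose A := \matrix_(i, j) f (tnth (in_tuple s) i) (tnth (in_tuple s) j).
pose w := (\row_(j < size s) v (tnth (in_tuple s) j)) *m \adj A.
exists (seq_fun w) => y /(tnthP (in_tuple s)) [j ->].
have /matrixP/(_ 0 j) : w *m A = sdet s f *: \row_j v (tnth (in_tuple s) j).
  by rewrite -mulmxA mul_adj_mx mul_mx_scalar.
rewrite !mxE => <-; rewrite (big_tnth _ _ s) /=.
by apply: eq_bigr => i _; rewrite seq_funE // !mxE.
Qed.

End SeqDet.

Lemma sdet_ker (R : idomainType) (I : eqType) (s : seq I)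
    (f : I -> I -> R) (w : I -> R) :
  sdet s f != 0 -> {in s, forall y, \sum_(x <- s) w x * f x y = 0} ->
  {in s, forall x, w x = 0}.
Proof.
move=> D0; set A := \matrix_(i, j) f (tnth (in_tuple s) i) (tnth (in_tuple s) j).
move=> w0 x /(tnthP (in_tuple s)) [i ->].
pose v := \row_(j < size s) w (tnth (in_tuple s) j).
have vA : v *m A = 0.
  apply/rowP => j; rewrite !mxE.
  rewrite -[RHS](w0 (tnth (in_tuple s) j)); last exact: (mem_tnth _ (in_tuple s)).
  by rewrite (big_tnth _ _ s) /=; apply: eq_bigr => k _; rewrite !mxE.
have /rowP/(_ i) : v *m A *m \adj A = 0 by rewrite vA mul0mx.
rewrite -mulmxA mul_mx_adj mul_mx_scalar !mxE => /eqP.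
by rewrite mulf_eq0 (negbTE D0) => /eqP.
Qed.

Lemma sdet_rmorph (R K : comNzRingType) (h : {rmorphism R -> K}) (I : Type)
    (s : seq I) f : sdet s (fun x y => h (f x y)) = h (sdet s f).
Proof.
by rewrite /sdet -det_map_mx; congr determinant; apply/matrixP=> i j; rewrite !mxE.
Qed.

(** * Finite commutative semigroups *)

Section CommSemigroup.
Variables (S : finType) (mul : S -> S -> S).
Hypotheses (mulA : associative mul) (mulC : commutative mul).
Local Notation "x ** y" := (mul x y) (at level 40, left associativity).

Lemma smulAC x y z : x ** y ** z = x ** z ** y.
Proof. by rewrite -mulA (mulC y) mulA. Qed.

Lemma smulCA x y z : x ** (y ** z) = y ** (x ** z).
Proof. by rewrite mulA (mulC x) -mulA. Qed.

Lemma smulACA x y z t : x ** y ** (z ** t) = x ** z ** (y ** t).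
Proof. by rewrite mulA (smulAC x) -mulA. Qed.

Lemma idemE e : (e \in idem mul) = (e ** e == e).
Proof. by rewrite inE. Qed.

Lemma idemM e f : e \in idem mul -> f \in idem mul -> e ** f \in idem mul.
Proof. by rewrite !idemE => /eqP ee /eqP ff; rewrite smulACA ee ff. Qed.

(* spow a n is the power a^(n+1). *)
Definition spow (a : S) n := iter n (mul a) a.

Lemma spowD a m n : spow a m ** spow a n = spow a (m + n).+1.
Proof. by elim: m => [|m IH] //=; rewrite -mulA IH. Qed.

Lemma seq_repeat (T : finType) (u : nat -> T) :
  exists i j, (i < j)%N /\ u i = u j.
Proof.
have : ~~ injectiveb (fun i : 'I_#|T|.+1 => u i).
  by apply/injectiveP => /leq_card; rewrite card_ord ltnn.
case/injectivePn => i [j ij uij].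
have [lt|gt|eq] := ltngtP i j.
- by exists i, j.
- by exists j, i.
- by rewrite (ord_inj eq) eqxx in ij.
Qed.

Lemma idem_power a : exists n, spow a n \in idem mul.
Proof.
have [i [j [ij aij]]] := seq_repeat (spow a).
pose p := (j - i)%N; have p0 : (0 < p)%N by rewrite subn_gt0.
have per k : spow a (i + k + p) = spow a (i + k).
  case: k => [|k]; first by rewrite addn0 subnKC // ltnW.
  by rewrite addnS addSn -addnA (addnC k) addnA subnKC 1?ltnW // -spowD -aij spowD.
have perq q k : spow a (i + k + q * p) = spow a (i + k).
  elim: q k => [|q IH] k; first by rewrite addn0.
  by rewrite mulSn addnA -(addnA i) IH addnA per.
(* As [spow a n] has exponent [n.+1], the exponent chosen is a multiple of the period [p] and at
   least [i.+1], from where the powers are periodic. *)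
pose n := (i.+1 * p).-1.
have nE : n.+1 = (i.+1 * p)%N by rewrite prednK // muln_gt0.
have ni : (i <= n)%N by rewrite -ltnS nE leq_pmulr.
exists n; rewrite idemE spowD -addnS nE -{1}(subnKC ni) perq subnKC //.
Qed.

Lemma fix_idem x w : x ** w = x ->
  exists f, [/\ f \in idem mul, x ** f = x & exists v, f = w ** v].
Proof.
move=> xw; have [n en] := idem_power w; exists (spow w n); split=> //.
  by elim: n {en} => //= n IH; rewrite mulA xw.
(* Squaring the idempotent exhibits a factor [w] even when the power is [w] itself. *)
by exists (spow w (n + n)); rewrite -(eqP (etrans (esym (idemE _)) en)) spowD.
Qed.

Lemma HtildeP s e : reflect
  [/\ e \in idem mul, s ** e = s & forall f, f \in idem mul -> s ** f = s -> f ** e = e]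
  (s \in Htilde mul e).
Proof.
rewrite [s \in _]inE; apply: (iffP and3P) => -[ei se].
  move=> /forall_inP He; split=> //; first exact/eqP.
  by move=> f fi sf; have := He f fi; rewrite sf eqxx => /eqP.
move=> He; split=> //; first exact/eqP.
by apply/forall_inP => f fi; apply/implyP => /eqP sf; apply/eqP/He.
Qed.

Lemma Htilde_uniq s e f : s \in Htilde mul e -> s \in Htilde mul f -> e = f.
Proof.
case/HtildeP=> ei se He /HtildeP [fi sf Hf].
by rewrite -(Hf e) // mulC He.
Qed.

(** * Elements with a given plus idempotent, and their group of units *)

Section OnePlus.
Variable e : S.
Hypothesis ei : e \in idem mul.
Local Notation G := (unitsG mul e).
Local Notation H := (Htilde mul e).

Let ee : e ** e = e. Proof. by apply/eqP; rewrite -idemE. Qed.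

Lemma Htilde_fix s : s \in H -> s ** e = s.
Proof. by case/HtildeP. Qed.

(** Every idempotent fixing [a] also fixes [a ** b], hence lies above [e]. *)
Lemma Htilde_factor a b : a ** e = a -> a ** b \in H -> a \in H.
Proof.
move=> ae /HtildeP [_ abe Hab]; apply/HtildeP; split=> // f fi af.
by apply: Hab => //; rewrite smulAC af.
Qed.

Lemma unitsP g : reflect (g ** e = g /\ exists2 h, h ** e = h & g ** h = e)
  (g \in G).
Proof.
have locP x : reflect (x ** e = x) (x \in local_monoid mul e).
  apply: (iffP imsetP) => [[y _ ->]|xe]; first by rewrite -mulA ee.
  by exists x; rewrite // (mulC e) xe.
rewrite inE; apply: (iffP andP) => -[/locP ge].
  by case/existsP => h /andP[/locP he /andP [/eqP gh _]]; split=> //; exists h.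
case=> h /locP he gh; split=> //.
by apply/existsP; exists h; rewrite he (mulC h) gh eqxx.
Qed.

Lemma units_fix g : g \in G -> g ** e = g. Proof. by case/unitsP. Qed.

Lemma units1 : e \in G.
Proof. by apply/unitsP; split=> //; exists e. Qed.

Lemma units_inv g : g \in G -> exists2 h, h \in G & g ** h = e.
Proof.
case/unitsP => ge [h he gh]; exists h => //.
by apply/unitsP; split=> //; exists g; rewrite // mulC.
Qed.

Lemma unitsM g h : g \in G -> h \in G -> g ** h \in G.
Proof.
case/unitsP => ge [g' ge' gg'] /unitsP [he [h' he' hh']].
apply/unitsP; split; first by rewrite -mulA he.
by exists (g' ** h'); [rewrite -mulA he'|rewrite smulACA gg' hh'].
Qed.

Lemma units_Htilde g : g \in G -> g \in H.
Proof.
case/unitsP => ge [h he gh]; apply/HtildeP; split=> // f fi gf.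
by rewrite -gh -{2}gf mulC smulAC.
Qed.

Lemma unit_actK g s : g \in G -> s \in H -> exists2 h, h \in G & h ** (g ** s) = s.
Proof.
move=> /units_inv [h hG gh] sH; exists h => //.
by rewrite mulA (mulC h) gh mulC Htilde_fix.
Qed.

Lemma act_Htilde g s : g \in G -> s \in H -> g ** s \in H.
Proof.
move=> gG sH; have [h hG hgs] := unit_actK gG sH.
apply: (@Htilde_factor _ h); last by rewrite mulC hgs.
by rewrite -mulA Htilde_fix.
Qed.

Lemma act_HtildeE g s : g \in G -> s ** e = s -> (g ** s \in H) = (s \in H).
Proof.
move=> gG se; apply/idP/idP => [|]; last exact: act_Htilde.
by rewrite mulC => /Htilde_factor; apply.
Qed.

(* The elements of H outside the group of units act nilpotently. *)
Lemma fixing_unit s a : s \in H -> s ** a = s -> e ** a \in G.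
Proof.
move=> /HtildeP [_ se Hs] /fix_idem [f [fi sf [v fv]]].
apply/unitsP; split; first by rewrite smulAC ee.
(* The idempotent [f = a ** v] fixes [s], hence lies above [e]; so [e ** v] inverts [e ** a]. *)
exists (e ** v); first by rewrite smulAC ee.
by rewrite smulACA ee -fv mulC Hs.
Qed.

Lemma GorbitP s x : reflect (exists2 g, g \in G & x = g ** s) (x \in Gorbit mul e s).
Proof. exact: imsetP. Qed.

Lemma Gorbit_refl s : s \in H -> s \in Gorbit mul e s.
Proof.
move=> sH; apply/GorbitP; exists e; first exact: units1.
by rewrite mulC Htilde_fix.
Qed.

Lemma Gorbit_sub s x : s \in H -> x \in Gorbit mul e s -> x \in H.
Proof. by move=> sH /GorbitP [g gG ->]; apply: act_Htilde. Qed.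

Lemma Gorbit_eq s x : s \in H -> x \in Gorbit mul e s ->
  Gorbit mul e x = Gorbit mul e s.
Proof.
move=> sH /GorbitP [g gG ->]; apply/setP => y.
apply/GorbitP/GorbitP => -[h hG ->].
  by exists (h ** g); rewrite ?mulA // unitsM.
have [k kG kgs] := unit_actK gG sH.
by exists (h ** k); rewrite ?unitsM // -mulA kgs.
Qed.

End OnePlus.

(** * Existence of the plus idempotent when every element is a product *)

Section Regular.
Hypothesis SS : square mul = [set: S].

(** Factoring repeatedly makes [s] a multiple of every iterate of [F]. Two iterates coincide, so
    some iterate [x] satisfies [x = x ** w]; an idempotent fixing [x] then fixes its multiple
    [s]. *)
Lemma ex_idem s : exists2 f, f \in idem mul & s ** f = s.
Proof.
have sq x : exists p : S * S, x == p.1 ** p.2.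
  have : x \in square mul by rewrite SS inE.
  by case/imset2P => a b _ _ ->; exists (a, b).
pose F x := (xchoose (sq x)).1; pose c x := (xchoose (sq x)).2.
have FE x : x = F x ** c x by apply/eqP; apply: (xchooseP (sq x)).
have step i d : exists w, iter i F s = iter (i + d).+1 F s ** w.
  elim: d => [|d [w ->]]; first by exists (c (iter i F s)); rewrite addn0 /= -FE.
  by exists (c (iter (i + d).+1 F s) ** w); rewrite addnS mulA /= -FE.
have [i [j [ij E]]] := seq_repeat (fun n => iter n F s).
have [w] := step i (j - i.+1)%N; rewrite -addSn subnKC // -E => xw.
have [f [fi xf _]] := fix_idem (esym xw); exists f => //.
case: i {E ij xw} xf => // i xf.
have [v] := step 0%N i; rewrite add0n => sv.
have {}sv : s = iter i.+1 F s ** v := sv.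
by rewrite {1}sv smulAC xf -sv.
Qed.

(** The minimum is the product of all idempotents fixing [s], with a starting factor from
    [ex_idem]. *)
Lemma ex_plus s : exists e, s \in Htilde mul e.
Proof.
suff [e ei [se He]] : exists2 e, e \in idem mul & s ** e = s /\
    forall f, f \in [seq f <- enum (idem mul) | s ** f == s] -> f ** e = e.
  exists e; apply/HtildeP; split=> // f fi sf; apply: He.
  by rewrite mem_filter sf eqxx mem_enum.
have : all (fun f => (f \in idem mul) && (s ** f == s))
   [seq f <- enum (idem mul) | s ** f == s].
  by apply/allP => f; rewrite mem_filter mem_enum => /andP [-> ->].
elim: [seq _ <- _ | _] => [|f r IH] /=.
  by have [f fi sf] := ex_idem s; exists f.
case/andP=> /andP [fi /eqP sf] /IH [e ei [se He]].
exists (f ** e); first exact: idemM.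
split=> [|h]; first by rewrite mulA sf.
rewrite inE => /predU1P [->|/He hE]; last by rewrite smulCA hE.
by rewrite mulA (eqP (etrans (esym (idemE _)) fi)).
Qed.

End Regular.

(** * The partial order on the semigroup *)

Lemma sleP s t : reflect (exists2 f, f \in idem mul & s = t ** f) (sle mul s t).
Proof.
apply: (iffP existsP) => [[f /andP [fi /eqP ->]]|[f fi ->]].
  by exists f.
by exists f; rewrite fi eqxx.
Qed.

Lemma sle_trans : transitive (sle mul).
Proof.
move=> y x z /sleP [f fi ->] /sleP [g gi ->]; apply/sleP.
by exists (g ** f); [exact: idemM|rewrite mulA].
Qed.

Lemma sle_anti : antisymmetric (sle mul).
Proof.
move=> x y /andP [/sleP [f fi xf] /sleP [g gi yg]].
have xf' : x ** f = x.
  by rewrite xf -mulA (eqP (etrans (esym (idemE _)) fi)).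
have yg' : y ** g = y.
  by rewrite yg -mulA (eqP (etrans (esym (idemE _)) gi)).
by rewrite xf -{1}yg' smulAC -xf -yg.
Qed.

End CommSemigroup.

(** * The factorization over the idempotents *)

Lemma uniq_flatten_map (I K : eqType) (ks : seq K) (F : K -> seq I) :
  uniq ks -> (forall k, uniq (F k)) ->
  (forall k l x, k \in ks -> l \in ks -> x \in F k -> x \in F l -> k = l) ->
  uniq (flatten (map F ks)).
Proof.
move=> uk uF; elim: ks uk => //= k ks IH /andP [kN uk] dis.
rewrite cat_uniq uF /= IH // ?andbT; last first.
  by move=> l m x lk mk; apply: dis; rewrite inE ?lk ?mk orbT.
apply/hasPn => x /flattenP [_ /mapP [l lk ->] xl]; apply: contra kN => xk.
by rewrite (dis k l x) // inE ?eqxx ?lk ?orbT.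
Qed.

Section Blocks.
Variables (S : finType) (mul : S -> S -> S).
Hypotheses (mulA : associative mul) (mulC : commutative mul).
Hypothesis SS : square mul = [set: S].
Variable C : numClosedFieldType.
Local Notation "x ** y" := (mul x y) (at level 40, left associativity).
Local Notation mob := (moebius mul C).

Let sle_refl s : sle mul s s.
Proof. by have [f fi sf] := ex_idem mulA mulC SS s; apply/sleP; exists f. Qed.

Lemma sdet_zeta (K : comNzRingType) :
  sdet (enum S) (fun s t => (sle mul s t)%:R : K) = 1.
Proof.
rewrite (@sdet_triangular _ _ _ (sle mul)) ?enum_uniq //.
- by rewrite big1 // => s _; rewrite sle_refl.
- by move=> y x z _ _ _; apply: sle_trans.
- by move=> x y _ _; apply: sle_anti.
- by move=> x y _ _; apply: contraNT => /negbTE ->.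
Qed.

Lemma zeta_unit : zeta mul C \in unitmx.
Proof. rewrite unitmxE.
by rewrite [\det _](sdet_enum S (fun s t => (sle mul s t)%:R)) sdet_zeta unitr1. Qed.

Lemma moebius_sum t s : \sum_(c | sle mul c s) mob t c = (t == s)%:R.
Proof.
have /matrixP/(_ (enum_rank t) (enum_rank s)) := mulVmx zeta_unit.
rewrite !mxE (inj_eq enum_rank_inj) => <-.
rewrite [RHS](reindex (@enum_rank S)) /=; last first.
  exact: onW_bij (enum_rank_bij S).
rewrite big_mkcond; apply: eq_bigr => c _; rewrite !mxE !enum_rankK.
by case: ifP; rewrite ?mulr1 ?mulr0.
Qed.

(** The function is defined by inverting a matrix, so its support has to be derived: [moebius_sum]
    expresses [mob t c] through the [mob t d] with [d] strictly below [c], and the number of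
    elements below decreases. *)
Lemma moebius_supp t c : mob t c != 0 -> sle mul t c.
Proof.
have [n] := ubnP #|[set d | sle mul d c]|; elim: n c => // n IH c cn mtc.
apply: contraNT mtc => ntc.
have := moebius_sum t c; rewrite (bigD1 c) ?sle_refl //= big1 ?addr0.
  move=> ->; have /negbTE -> // : t != c.
  by apply: contraNneq ntc => ->; apply: sle_refl.
move=> d /andP [dc ndc]; apply: contraNeq ntc => /IH td.
apply: (sle_trans mulA mulC (td _) dc).
rewrite -ltnS; apply: leq_trans cn; rewrite ltnS; apply: proper_card.
apply/properP; split.
  apply/fintype.subsetP => x; rewrite !inE => xd.
  exact: (sle_trans mulA mulC xd dc).
exists c; rewrite !inE ?sle_refl //; apply: contraNN ndc => cd.
by apply/eqP/(sle_anti mulA mulC); rewrite dc cd.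
Qed.

(* The value of the generic functional s |-> x_s at the element
   sum_(t <= c) mu(t, c) t of the semigroup algebra. *)
Definition yvar c : {mpoly C[#|S|]} :=
  \sum_(t | sle mul t c) mob t c *: xvar C t.

(** Moebius inversion. *)
Lemma yvar_sum s : \sum_(c | sle mul c s) yvar c = xvar C s.
Proof.
have yE c : yvar c = \sum_t mob t c *: xvar C t.
  rewrite /yvar big_mkcond; apply: eq_bigr => t _; case: ifPn => // ntc.
  have [->|/moebius_supp tc] := eqVneq (mob t c) 0; first by rewrite scale0r.
  by rewrite tc in ntc.
rewrite (eq_bigr _ (fun c _ => yE c)) exchange_big /= (bigD1 s) //=.
rewrite -scaler_suml moebius_sum eqxx scale1r big1 ?addr0 // => t ts.
by rewrite -scaler_suml moebius_sum (negbTE ts) scale0r.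
Qed.

(** An element [c] below [s] corresponds to the idempotent $c^+$: if [c = s ** f], then $fc^+=c^+$,
    hence $sc^+=c$. *)
Lemma sum_sle (V : nmodType) (F : S -> V) s :
  \sum_(c | sle mul c s) F c =
  \sum_(f | (f \in idem mul) && (s ** f \in Htilde mul f)) F (s ** f).
Proof.
pose pl c := xchoose (ex_plus mulA mulC SS c).
have plP c : c \in Htilde mul (pl c) by exact: (xchooseP (ex_plus mulA mulC SS c)).
rewrite (reindex_onto (fun f => s ** f) pl).
  apply: eq_bigl => f; apply/andP/andP => [[_ /eqP pf]|[fi sf]].
    by have := plP (s ** f); rewrite pf => sf; have /HtildeP [] := sf.
  split; first by apply/sleP; exists f.
  by apply/eqP; apply: (Htilde_uniq mulC (plP _) sf).
move=> c /sleP [f fi cf].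
have /HtildeP [_ ce He] := plP c.
have ff : f ** f = f by apply/eqP; rewrite -idemE.
have cf' : c ** f = c by rewrite cf -mulA ff.
by rewrite -(He f) // mulA -cf ce.
Qed.

(** An element of [Htilde mul f] below [s ** t] factors as [(s ** f) ** (t ** f)], with both factors
    in [Htilde mul f]. So the matrix is $Z^TYZ$, with $Z$ the unitriangular zeta matrix and $Y$
    block diagonal over the idempotents. *)
Lemma sgdet_blocks : sgdet mul C = \prod_(e in idem mul)
  sdet (enum (Htilde mul e))
    (fun s t => if s ** t \in Htilde mul e then yvar (s ** t) else 0).
Proof.
(* This is the form in the new basis, defined on all of [S] at once so that the product of matrices
   makes sense before the blocks are separated. *)
pose Y a b := if [exists e, [&& a \in Htilde mul e, b \in Htilde mul e &
   a ** b \in Htilde mul e]] then yvar (a ** b) else 0.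
have YE e a b : a \in Htilde mul e -> b \in Htilde mul e ->
    Y a b = if a ** b \in Htilde mul e then yvar (a ** b) else 0.
  move=> ae be; rewrite /Y; case: existsP => [[f /and3P [af bf abf]]|nx].
    by rewrite (Htilde_uniq mulC ae af) abf.
  by case: ifP => // abe; case: nx; exists e; rewrite ae be abe.
have Y0 e f a b : a \in Htilde mul e -> b \in Htilde mul f -> e != f ->
    Y a b = 0.
  move=> ae bf; apply: contraNeq; rewrite /Y; case: existsP => //; last by rewrite eqxx.
  move=> [g /and3P [ag bg _]] _.
  by rewrite (Htilde_uniq mulC ae ag) (Htilde_uniq mulC bf bg).
pose z s t : {mpoly C[#|S|]} := (sle mul s t)%:R.
have XE s t : xvar C (s ** t) =
   \sum_(a <- enum S) z a s * \sum_(b <- enum S) Y a b * z b t.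
  have zE (V : {mpoly C[#|S|]}) a u : z a u * V = if sle mul a u then V else 0.
    by rewrite /z; case: ifP; rewrite ?mul1r ?mul0r.
  rewrite -yvar_sum sum_sle big_enum /=.
  rewrite (eq_bigr _ (fun a _ => zE _ a s)) -big_mkcond /= sum_sle.
  rewrite big_mkcondr [RHS]big_mkcondr; apply: eq_bigr => f fi.
  rewrite big_enum /=.
  under [in RHS]eq_bigr => b _ do rewrite mulrC zE.
  rewrite -big_mkcond /= sum_sle.
  case: ifPn => [stf|nstf].
    have ff : f ** f = f by apply/eqP; rewrite -idemE.
    have Ef : s ** f ** (t ** f) = s ** t ** f by rewrite smulACA // ff.
    have sf : s ** f \in Htilde mul f.
      by apply: (@Htilde_factor _ _ mulA mulC f fi _ (t ** f));
        rewrite -?mulA ?ff // mulA Ef.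
    have tf : t ** f \in Htilde mul f.
      by apply: (@Htilde_factor _ _ mulA mulC f fi _ (s ** f));
        rewrite -?mulA ?ff // mulA mulC Ef.
    rewrite sf (bigD1 f) ?fi //= (YE f) // Ef stf big1 ?addr0 //.
    move=> g /andP [/andP [gi tg] gf]; apply: Y0 sf tg _; by rewrite eq_sym.
  case: ifP => // sf; rewrite big1 // => g /andP [gi tg].
  have [eg|/Y0 -> //] := eqVneq f g.
  have ff : f ** f = f by apply/eqP; rewrite -idemE.
  by rewrite -eg in tg *; rewrite (YE f) // smulACA // ff (negbTE nstf).
rewrite [LHS](sdet_enum S (fun s t => xvar C (s ** t))).
rewrite (eq_sdet (fun s t _ _ => XE s t)).
rewrite (sdet_mul _ (fun s a => z a s)) sdet_tr sdet_zeta mul1r.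
rewrite sdet_mul sdet_zeta mulr1.
(* Grouping the elements by their plus idempotent makes the blocks contiguous. *)
rewrite (@sdet_perm _ _ _ (flatten [seq enum (Htilde mul e) | e <- enum (idem mul)])).
  rewrite sdet_flatten ?enum_uniq //.
    rewrite big_enum; apply: eq_bigr => e _; apply: eq_sdet => s t.
    by rewrite !mem_enum; apply: YE.
  by move=> e f s t _ _ ef; rewrite !mem_enum => se tf; apply: Y0 ef.
apply: uniq_perm; rewrite ?enum_uniq //.
  apply: uniq_flatten_map => [|e|e f s _ _]; rewrite ?enum_uniq //.
  by rewrite !mem_enum; apply: (Htilde_uniq mulC).
move=> s; rewrite mem_enum; symmetry; apply/flatten_mapP.
have [e se] := ex_plus mulA mulC SS s; exists e; rewrite mem_enum //.
by case/HtildeP: se.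
Qed.

End Blocks.

(** * Characters of the group of units *)

Section Characters.
Variables (S : finType) (mul : S -> S -> S).
Hypotheses (mulA : associative mul) (mulC : commutative mul).
Variable C : numClosedFieldType.
Local Notation "x ** y" := (mul x y) (at level 40, left associativity).
Variable e : S.
Hypothesis ei : e \in idem mul.
Local Notation G := (unitsG mul e).
Local Notation character := (@is_char S mul C e).

Let ee : e ** e = e. Proof. by apply/eqP; rewrite -idemE. Qed.
Let eG : e \in G. Proof. exact: units1. Qed.

Lemma units_idem f : f \in G -> f \in idem mul -> f = e.
Proof.
move=> fG; rewrite idemE => /eqP ff; have [h hG fh] := units_inv mulA mulC ei fG.
by rewrite -(units_fix mulA mulC ei fG) -fh mulA ff fh.
Qed.

Lemma spow_units g n : g \in G -> spow mul g n \in G.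
Proof. by move=> gG; elim: n => //= n IH; apply: unitsM. Qed.

Lemma units_order g : g \in G -> exists n, spow mul g n = e.
Proof.
move=> gG; have [n gn] := idem_power mulA g; exists n.
by apply: units_idem => //; apply: spow_units.
Qed.

Lemma sum_units_trans (V : nmodType) (F : S -> V) g : g \in G ->
  \sum_(x in G) F (g ** x) = \sum_(x in G) F x.
Proof.
move=> gG; have [h hG gh] := units_inv mulA mulC ei gG.
have K x : x \in G -> h ** (g ** x) = x.
  by move=> xG; rewrite mulA (mulC h) gh mulC (units_fix mulA mulC ei xG).
have K' x : x \in G -> g ** (h ** x) = x.
  by move=> xG; rewrite mulA gh mulC (units_fix mulA mulC ei xG).
rewrite [RHS](reindex_onto (mul g) (mul h)) //=.
apply: eq_bigl => x; apply/idP/andP => [xG|[gxG /eqP <-]].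
  by rewrite unitsM ?K.
exact: unitsM.
Qed.

Section OneChar.
Variable chi : {ffun S -> C}.
Hypothesis ch : character chi.

Lemma char0 g : g \notin G -> chi g = 0. Proof. by case: ch => _ _; apply. Qed.

Lemma char_neq0 g : g \in G -> chi g != 0. Proof. by case: ch => H _ _; apply: H. Qed.

Lemma charM g h : g \in G -> h \in G -> chi (g ** h) = chi g * chi h.
Proof. by case: ch => _ H _; apply: H. Qed.

Lemma chi_one : chi e = 1.
Proof.
by apply: (mulfI (char_neq0 eG)); rewrite mulr1 -charM ?ee.
Qed.

Lemma char_unity g : g \in G -> exists n, chi g ^+ n.+1 = 1.
Proof.
move=> gG; have [n gn] := units_order gG; exists n; rewrite -chi_one -gn.
elim: {gn} n => [|n IH]; first by rewrite expr1.
by rewrite /= exprS IH charM //; apply: spow_units.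
Qed.

Lemma char_norm g : g \in G -> chi g * Num.conj (chi g) = 1.
Proof.
move=> gG; have [n gn] := char_unity gG; rewrite -normCK.
suff -> : `|chi g| = 1 by rewrite expr1n.
by apply/eqP; rewrite -(@pexpr_eq1 _ _ n.+1) // -normrX gn normr1.
Qed.

(** Translation by [g] permutes [G], so it leaves the product of all values of [chi] unchanged,
    while multiplying it by [chi g ^+ #|G|]. *)
Lemma char_unityG g : g \in G -> chi g ^+ #|G| = 1.
Proof.
move=> gG.
have P0 : \prod_(x in G) chi x != 0.
  by apply/prodf_neq0 => x xG; apply: char_neq0.
apply: (mulIf P0); rewrite mul1r.
have [h hG gh] := units_inv mulA mulC ei gG.
have K x : x \in G -> h ** (g ** x) = x.
  by move=> xG; rewrite mulA (mulC h) gh mulC (units_fix mulA mulC ei xG).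
have K' x : x \in G -> g ** (h ** x) = x.
  by move=> xG; rewrite mulA gh mulC (units_fix mulA mulC ei xG).
rewrite [RHS](reindex_onto (mul g) (mul h)) //=.
rewrite -prodr_const -big_split /=.
rewrite [RHS](eq_bigl (mem G)); first by apply: eq_bigr => x xG; rewrite charM.
move=> x; apply/andP/idP => [[gxG /eqP <-]|xG]; first exact: unitsM.
by rewrite unitsM ?K.
Qed.

End OneChar.

Definition char_conj (chi : {ffun S -> C}) := [ffun g => Num.conj (chi g)].
Definition char_mul (chi psi : {ffun S -> C}) := [ffun g => chi g * psi g].

Lemma is_char_conj chi : character chi -> character (char_conj chi).
Proof.
move=> ch; split=> [g gG|g h gG hG|g gN]; rewrite !ffunE.
- by rewrite conjC_eq0 char_neq0.
- by rewrite charM // rmorphM.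
- by rewrite char0 // conjC0.
Qed.

Lemma char_conjK : involutive char_conj.
Proof. by move=> chi; apply/ffunP => g; rewrite !ffunE conjCK. Qed.

Lemma is_char_mul chi psi :
  character chi -> character psi -> character (char_mul chi psi).
Proof.
move=> ch cp; split=> [g gG|g h gG hG|g gN]; rewrite !ffunE.
- by rewrite mulf_neq0 ?char_neq0.
- by rewrite !charM // mulrACA.
- by rewrite char0 // mul0r.
Qed.

Lemma char_mulK chi psi : character chi -> character psi ->
  char_mul (char_conj chi) (char_mul chi psi) = psi.
Proof.
move=> ch cp; apply/ffunP => g; rewrite !ffunE.
have [gG|gN] := boolP (g \in G); last by rewrite (char0 cp) // !mulr0.
by rewrite mulrA (mulrC (Num.conj _)) char_norm // mul1r.
Qed.

Definition char1f : {ffun S -> C} := [ffun g => (g \in G)%:R].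

Lemma is_char1 : character char1f.
Proof.
split=> [g gG|g h gG hG|g gN]; rewrite !ffunE ?gG ?oner_eq0 //.
- by rewrite hG unitsM // mulr1.
- by rewrite (negbTE gN).
Qed.

(** The values of a character are roots of ['X^(#|G|) - 1] on [G] and zero outside, so the
    characters are found among finitely many functions. *)
Lemma finite_chars : exists cs : seq {ffun S -> C},
  uniq cs /\ forall chi, (chi \in cs) <-> character chi.
Proof.
have [r Er] := closed_field_poly_normal ('X^(#|G|) - 1 : {poly C}).
have G0 : (0 < #|G|)%N by apply/card_gt0P; exists e.
have lc1 : lead_coef ('X^(#|G|) - 1 : {poly C}) = 1.
  by rewrite lead_coefXnsubC.
rewrite lc1 scale1r in Er.
pose r0 := 0 :: r.
pose F (p : {ffun S -> 'I_(size r0)}) : {ffun S -> C} := [ffun g => r0`_(p g)].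
exists (undup [seq chi <- map F (enum {ffun S -> 'I_(size r0)}) | `[< character chi >]]).
split=> [|chi]; first exact: undup_uniq.
rewrite mem_undup mem_filter; split=> [/andP [/asboolP]|ch] //.
rewrite (introT (asboolP _) ch) /=; apply/mapP.
have chi_r g : chi g \in r0.
  rewrite inE; have [gG|gN] := boolP (g \in G); last by rewrite (char0 ch) ?eqxx.
  apply/orP; right; rewrite -root_prod_XsubC -Er.
  by rewrite rootE !hornerE ?hornerXn char_unityG // subrr.
exists [ffun g => Ordinal (etrans (index_mem _ _) (chi_r g))]; rewrite ?mem_enum //.
by apply/ffunP => g; rewrite !ffunE /= nth_index.
Qed.

(* The regular representation of the abelian group G is diagonalizable in some
   basis, and the diagonal entries of the matrices are characters. *)
Lemma char_sep g : g \in G -> g != e -> exists chi, character chi /\ chi g != 1.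
Proof.
move=> gG ge.
have [n En] : exists n, #|G| = n.+1.
  by exists #|G|.-1; rewrite prednK //; apply/card_gt0P; exists e.
pose v (i : 'I_n.+1) : S := enum_val (cast_ord (esym En) i).
have vG i : v i \in G by apply: enum_valP.
have v_inj : injective v by move=> i j /enum_val_inj /cast_ord_inj.
have v_surj x : x \in G -> exists i, v i = x.
  move=> xG; exists (cast_ord En (enum_rank_in eG x)).
  by rewrite /v cast_ordK enum_rankK_in.
pose rho x : 'M[C]_n.+1 := \matrix_(i, j) (v j == x ** v i)%:R.
have rhoM x y : x \in G -> y \in G -> rho x *m rho y = rho (x ** y).
  move=> xG yG; apply/matrixP => i j; rewrite !mxE.
  have [k vk] := v_surj (x ** v i) (unitsM mulA mulC ei xG (vG i)).
  rewrite (bigD1 k) //= big1 ?addr0 => [|l lk]; rewrite !mxE.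
    by rewrite vk eqxx mul1r mulA (mulC y).
  by rewrite -vk (inj_eq v_inj) (negbTE lk) mul0r.
have rho1 : rho e = 1%:M.
  apply/matrixP => i j; rewrite !mxE (mulC e) (units_fix mulA mulC ei (vG i)).
  by rewrite (inj_eq v_inj) eq_sym.
have rhoX x k : x \in G -> rho x ^+ k.+1 = rho (spow mul x k).
  move=> xG; elim: k => [|k IH]; first by rewrite expr1.
  by rewrite exprS IH -[_ * _]/(_ *m _) rhoM // spow_units.
(* Some power of [x] is [e], so [rho x] is annihilated by a polynomial ['X^(k.+1) - 1], which has
   simple roots in characteristic zero. *)
have rho_diag x : x \in G -> exists2 P, P \in unitmx & similar_diag P (rho x).
  move=> xG; apply/diagonalizableP; have [k xk] := units_order xG.
  have [r Er] := closed_field_poly_normal ('X^(k.+1) - 1 : {poly C}).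
  rewrite lead_coefXnsubC // scale1r in Er.
  exists r; first by rewrite -separable_prod_XsubC -Er separable_Xn_sub_1 // pnatr_eq0.
  rewrite -Er; apply: mxminpoly_min.
  by rewrite rmorphB rmorphXn /= horner_mx_X rmorph1 rhoX // xk rho1 subrr.
(* Commuting diagonalizable matrices are diagonal in a common basis. *)
have [P Pu Pd] : exists2 P, P \in unitmx &
    all [pred A | similar_diag P A] [seq rho x | x <- enum G].
  apply/codiagonalizableP; split=> [A B|A].
    move=> /mapP [x xG ->] /mapP [y yG ->]; rewrite !mem_enum in xG yG.
    by rewrite /comm_mx !rhoM // mulC.
  by move=> /mapP [x]; rewrite mem_enum => xG ->; apply: rho_diag.
pose D x := P *m rho x *m invmx P.
have Dd x i j : x \in G -> i != j -> D x i j = 0.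
  move=> xG ij; have /allP/(_ (rho x)) := Pd.
rewrite map_f ?mem_enum // => /(_ isT) /=.
  rewrite /similar_to mxred.conjumx // => /is_diag_mxP.
  exact.
have DM x y : x \in G -> y \in G -> D x *m D y = D (x ** y).
  by move=> xG yG; rewrite /D -rhoM // !mulmxA mulmxKV.
have D1 : D e = 1%:M by rewrite /D rho1 mulmx1 mulmxV.
have DMi x y i : x \in G -> y \in G -> D (x ** y) i i = D x i i * D y i i.
  move=> xG yG; rewrite -DM // mxE (bigD1 i) //= big1 ?addr0 // => j ji.
  by rewrite Dd ?mul0r // eq_sym.
pose d i : {ffun S -> C} := [ffun x => if x \in G then D x i i else 0].
have dch i : character (d i).
  split=> [x xG|x y xG yG|x xN]; rewrite !ffunE.
  - have [h hG xh] := units_inv mulA mulC ei xG; rewrite xG.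
    have := DMi _ _ i xG hG; rewrite xh D1 mxE eqxx => /esym/eqP.
    by apply: contraTneq => ->; rewrite mul0r eq_sym oner_eq0.
  - by rewrite xG yG unitsM // DMi.
  - by rewrite (negbTE xN).
suff [i di] : exists i, d i g != 1 by exists (d i).
(* If all diagonal characters were 1 at [g], then [rho g] would be the identity, which its diagonal
   entry at [e] contradicts. *)
apply/existsP; apply: contraT => /existsPn dg.
have Dg : D g = 1%:M.
  apply/matrixP => i j; rewrite [RHS]mxE; have [<-|ij] := eqVneq i j; last by rewrite Dd.
  by apply/eqP; have := dg i; rewrite negbK ffunE gG.
have [i vi] := v_surj e eG.
have : rho g = 1%:M.
  by rewrite -[rho g](mulKmx Pu) -[_ *m rho g](mulmxKV Pu) -/(D g) Dg mul1mx mulVmx.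
move/matrixP/(_ i i)/eqP; rewrite !mxE eqxx vi (units_fix mulA mulC ei gG).
by rewrite [e == g]eq_sym (negbTE ge) eq_sym oner_eq0.
Qed.

(** * Orthogonality relations for characters *)

Section Orthogonality.
Variable cs : seq {ffun S -> C}.
Hypotheses (csu : uniq cs) (csP : forall chi, (chi \in cs) <-> character chi).

(** Translation by [g] shows that multiplying the sum by [psi g] does not change it; if some
    [psi g != 1], it vanishes. *)
Lemma sum_char psi : character psi ->
  \sum_(g in G) psi g = if psi == char1f then #|G|%:R else 0.
Proof.
move=> cp; case: eqP => [->|np].
  rewrite (eq_bigr (fun=> 1)) => [|g gG]; last by rewrite ffunE gG.
  by rewrite sumr_const.
have [g gG pg] : exists2 g, g \in G & psi g != 1.
  apply/exists_inP; apply: contra_notT np => /exists_inPn H.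
  apply/ffunP => g; rewrite ffunE; have [gG|gN] := boolP (g \in G).
    by apply/eqP; have := H g gG; rewrite negbK.
  by rewrite (char0 cp).
have : (1 - psi g) * \sum_(h in G) psi h = 0.
  rewrite mulrBl mul1r mulr_sumr -(sum_units_trans psi gG).
  rewrite -sumrB big1 // => h hG.
  by rewrite (charM cp) // subrr.
by move/eqP; rewrite mulf_eq0 subr_eq0 eq_sym (negbTE pg) => /eqP.
Qed.

Lemma perm_char_mul chi : character chi -> perm_eq (map (char_mul chi) cs) cs.
Proof.
move=> ch; have inj : {in cs &, injective (char_mul chi)}.
  by move=> p q /csP cp /csP cq E; rewrite -(char_mulK ch cp) E char_mulK.
have mu : uniq (map (char_mul chi) cs) by rewrite map_inj_in_uniq.
apply: uniq_perm => //.
apply: (uniq_min_size mu _ _).2; last by rewrite size_map.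
by move=> _ /mapP [p /csP cp ->]; apply/csP/is_char_mul.
Qed.

Lemma sum_chars g : g \in G ->
  \sum_(chi <- cs) chi g = if g == e then #|G|%:R else 0.
Proof.
move=> gG.
have S0 h : h \in G -> h != e -> \sum_(chi <- cs) chi h = 0.
  move=> hG he; have [psi [cp ph]] := char_sep hG he.
  have : (1 - psi h) * \sum_(chi <- cs) chi h = 0.
    rewrite mulrBl mul1r mulr_sumr -{1}(perm_big _ (perm_char_mul cp)) big_map /=.
    by rewrite -sumrB big1 // => chi _; rewrite ffunE subrr.
  by move/eqP; rewrite mulf_eq0 subr_eq0 eq_sym (negbTE ph) => /eqP.
case: eqP => [->|/eqP ge]; last exact: S0.
(* By [S0] only [g = e] contributes to the double sum; after exchanging the sums only the trivial
   character does. This counts the characters. *)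
have -> : \sum_(chi <- cs) chi e = \sum_(g in G) \sum_(chi <- cs) chi g.
  by rewrite (bigD1 e) //= [X in _ + X]big1 ?addr0 // => h /andP [hG he]; apply: S0.
rewrite exchange_big /= (bigD1_seq char1f) //=; last exact/csP/is_char1.
rewrite sum_char ?eqxx; last exact: is_char1.
rewrite big1_seq ?addr0 // => chi /andP [ne /csP ch].
by rewrite sum_char // (negbTE ne).
Qed.

End Orthogonality.

End Characters.

(** * The factorization over the characters *)

Section Local.
Variables (S : finType) (mul : S -> S -> S).
Hypotheses (mulA : associative mul) (mulC : commutative mul).
Variable C : numClosedFieldType.
Local Notation "x ** y" := (mul x y) (at level 40, left associativity).
Variable e : S.
Hypothesis ei : e \in idem mul.
Local Notation G := (unitsG mul e).
Local Notation H := (Htilde mul e).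
Local Notation character := (@is_char S mul C e).
Variable Tr : {set S}.
Hypothesis repsT : is_reps mul e Tr.
Variables (K : idomainType) (iota : {rmorphism C -> K}).

Let ee : e ** e = e. Proof. by apply/eqP; rewrite -idemE. Qed.
Let eG : e \in G. Proof. exact: units1. Qed.

Lemma unit_factor x y : x ** e = x -> y ** e = y -> x ** y \in G -> x \in G.
Proof.
move=> xe ye /(unitsP mulA mulC ei) [_ [h he xyh]].
by apply/(unitsP mulA mulC ei); split=> //; exists (y ** h); rewrite -?mulA ?he // mulA.
Qed.

Lemma reps_Htilde s : s \in Tr -> s \in H.
Proof. by case: repsT => /and3P [_ /fintype.subsetP TH _] _; apply: TH. Qed.

Lemma reps1 : e \in Tr. Proof. by case: repsT. Qed.

Lemma reps_ex s : s \in H -> exists2 t, t \in Tr & s \in Gorbit mul e t.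
Proof.
move=> sH; case: repsT => /and3P [_ _ /forall_inP HT] _.
have /cards1P [t Et] := HT (Gorbit mul e s) (imset_f _ sH).
have : t \in Tr :&: Gorbit mul e s by rewrite Et set11.
rewrite inE => /andP [tT ts]; exists t => //.
by rewrite (Gorbit_eq mulA mulC ei sH ts) Gorbit_refl.
Qed.

Lemma reps_uniq s t : s \in Tr -> t \in Tr -> t \in Gorbit mul e s -> s = t.
Proof.
move=> sT tT ts; case: repsT => /and3P [_ _ /forall_inP HT] _.
have sH := reps_Htilde sT.
have /cards1P [u Eu] := HT (Gorbit mul e s) (imset_f _ sH).
have /set1P -> : s \in [set u] by rewrite -Eu inE sT Gorbit_refl.
by have /set1P -> : t \in [set u] by rewrite -Eu inE tT.
Qed.

Lemma reps_unit r : r \in Tr -> r \in G -> r = e.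
Proof.
move=> rT rG; symmetry; apply: reps_uniq reps1 rT _.
by apply/GorbitP; exists r => //; rewrite (units_fix mulA mulC ei rG).
Qed.

Section OneChar.
Variable chi : {ffun S -> C}.
Hypothesis ch : character chi.

(* nzchi s says that s e_chi is nonzero in the contracted algebra of H^0, where
   e_chi is the primitive idempotent of C G attached to chi. *)
Definition nzchi s :=
  (s \in H) && [forall g in G, (g ** s == s) ==> (chi g == 1)].

Lemma nzchiP s : reflect
  (s \in H /\ forall g, g \in G -> g ** s = s -> chi g = 1) (nzchi s).
Proof.
apply: (iffP andP) => -[sH /=].
  move/forall_inP => st; split=> // g gG gs; apply/eqP.
  by have := st g gG; rewrite gs eqxx.
move=> st; split=> //; apply/forall_inP => g gG; apply/implyP => /eqP gs.
by rewrite st.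
Qed.

Lemma nzchi_Htilde s : nzchi s -> s \in H. Proof. by case/andP. Qed.

Lemma nzchi_act g s : g \in G -> nzchi s -> nzchi (g ** s).
Proof.
move=> gG /nzchiP [sH st]; apply/nzchiP; split; first exact: act_Htilde.
move=> h hG hgs; apply: st => //.
have [k kG kgs] := unit_actK mulA mulC ei gG sH.
by rewrite -{1}kgs smulCA // hgs kgs.
Qed.

Lemma nzchi_orbit s h : s \in H -> h \in Gorbit mul e s -> nzchi h -> nzchi s.
Proof.
move=> sH /GorbitP [g gG ->] nz.
have [k kG <-] := unit_actK mulA mulC ei gG sH.
exact: nzchi_act.
Qed.

Lemma nzchi1 : nzchi e.
Proof.
apply/nzchiP; split=> [|g gG]; first exact: units_Htilde.
by rewrite (units_fix mulA mulC ei gG) => ->; apply: (chi_one mulA mulC ei ch).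
Qed.

Local Notation T := (Tchi mul e chi Tr).

Lemma stabE s : s \in H ->
  (stabG mul e (Some s) \subset kerG mul e chi) = nzchi s.
Proof.
move=> sH; have stE g : g \in G ->
    (g \in stabG mul e (Some s)) = (g ** s == s).
  by move=> gG; rewrite [g \in _]inE gG /= /mulH act_Htilde.
apply/fintype.subsetP/nzchiP => [st|[_ st] g gs].
  split=> // g gG /eqP gs; have := st g; rewrite stE // => /(_ gs).
  by rewrite inE => /andP [_ /eqP].
have gG : g \in G by move: gs; rewrite inE => /andP [].
by rewrite inE gG st ?eqxx //; apply/eqP; rewrite -stE.
Qed.

Lemma TchiE s : (s \in T) = (s \in Tr) && nzchi s.
Proof.
rewrite inE; have [sT|//] := boolP (s \in Tr).
by rewrite stabE // reps_Htilde.
Qed.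

Lemma Tchi_reps s : s \in T -> s \in Tr.
Proof. by rewrite TchiE => /andP []. Qed.

Lemma Tchi_nz s : s \in T -> nzchi s.
Proof. by rewrite TchiE => /andP []. Qed.

Lemma Tchi_Htilde s : s \in T -> s \in H.
Proof. by move/Tchi_reps/reps_Htilde. Qed.

Lemma Tchi_fix s : s \in T -> s ** e = s.
Proof. by move/Tchi_Htilde/(Htilde_fix). Qed.

Lemma Tchi1 : e \in T.
Proof. by rewrite TchiE reps1 nzchi1. Qed.

(* The coordinate of h e_chi along w e_chi. *)
Definition coef (w h : S) : C :=
  if [pick g in G | h == g ** w] is Some g then chi g else 0.

(** Two units carrying [w] to the same element differ by one that fixes [w]; hence [coef] does not
    depend on the unit picked. *)
Lemma nzchi_inj w g h : nzchi w -> g \in G -> h \in G -> g ** w = h ** w ->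
  chi g = chi h.
Proof.
move=> /nzchiP [wH st] gG hG gw; have [k kG hk] := units_inv mulA mulC ei hG.
have kh1 : chi (k ** g) = 1.
  apply: st; first exact: unitsM.
  by rewrite -mulA gw mulA (mulC k) hk mulC Htilde_fix.
rewrite -[LHS]mul1r -(chi_one mulA mulC ei ch) -hk (charM ch) // -mulrA -(charM ch) //.
by rewrite kh1 mulr1.
Qed.

Lemma coefE w g : nzchi w -> g \in G -> coef w (g ** w) = chi g.
Proof.
move=> nz gG; rewrite /coef; case: pickP => [h /andP [hG /eqP gw]|/(_ g)].
  by apply: (nzchi_inj nz) => //.
by rewrite gG eqxx.
Qed.

Lemma coef_eq0 w h : h \notin Gorbit mul e w -> coef w h = 0.
Proof.
move=> hw; rewrite /coef; case: pickP => // g /andP [gG /eqP hg].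
by case/GorbitP: hw; exists g.
Qed.

Lemma coef_self w : nzchi w -> coef w w = 1.
Proof.
move=> nz; have wH := nzchi_Htilde nz.
by rewrite -{2}(Htilde_fix wH) mulC coefE // (chi_one mulA mulC ei ch).
Qed.

Lemma coef_act w g h : nzchi w -> g \in G -> h ** e = h ->
  coef w (g ** h) = chi g * coef w h.
Proof.
move=> nz gG he; have [/GorbitP [k kG ->]|nh] := boolP (h \in Gorbit mul e w).
  by rewrite mulA !coefE ?(charM ch) // unitsM.
rewrite (coef_eq0 nh) mulr0 coef_eq0 //; apply: contra nh => /GorbitP [k kG gh].
have [g' g'G gg'] := units_inv mulA mulC ei gG.
apply/GorbitP; exists (g' ** k); first exact: unitsM.
by rewrite -mulA -gh mulA (mulC g') gg' mulC.
Qed.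

(* A functional on the contracted algebra of H^0 which factors through the
   multiplication by e_chi. *)
Definition chifun (f : S -> K) : Prop :=
  (forall g h, g \in G -> h ** e = h -> f (g ** h) = iota (chi g) * f h) /\
  (forall h, h ** e = h -> h \notin H -> f h = 0).

(** If [h] lies in [H], some unit [g] with [chi g != 1] fixes it, so that $(1-\chi(g))f(h)=0$. *)
Lemma chifun_nz f h : chifun f -> h ** e = h -> ~~ nzchi h -> f h = 0.
Proof.
move=> [fG f0] he; have [hH|/f0 -> //] := boolP (h \in H).
rewrite /nzchi hH /= => /forall_inPn [g gG].
rewrite negb_imply => /andP [/eqP gh g1].
have /eqP : (1 - iota (chi g)) * f h = 0.
  by rewrite mulrBl mul1r -fG // gh subrr.
by rewrite mulf_eq0 subr_eq0 -(rmorph1 iota) (inj_eq (fmorph_inj _)) eq_sym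
  (negbTE g1) => /eqP.
Qed.

Lemma chifun_shift f t : t ** e = t -> chifun f -> chifun (fun h => f (h ** t)).
Proof.
move=> te [fG f0]; split=> [g h gG he|h he hH].
  by rewrite -mulA fG // -mulA te.
apply: f0; first by rewrite -mulA te.
by apply: contra hH => /(Htilde_factor mulA mulC ei he).
Qed.

Lemma chifun_coef w : nzchi w -> chifun (fun h => iota (coef w h)).
Proof.
move=> nz; split=> [g h gG he|h he hH]; first by rewrite coef_act // rmorphM.
rewrite coef_eq0 ?rmorph0 //; apply: contra hH.
by apply: Gorbit_sub => //; apply: nzchi_Htilde nz.
Qed.

(** At most one summand is nonzero, that of the representative of the orbit of [h]. *)
Lemma chifun_expand f h : chifun f -> h ** e = h ->
  f h = \sum_(s <- enum T) iota (coef s h) * f s.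
Proof.
move=> cf he; rewrite big_enum /=.
have [nz|nn] := boolP (nzchi h); last first.
  rewrite (chifun_nz cf) // big1 // => s sT; rewrite coef_eq0 ?rmorph0 ?mul0r //.
  apply: contra nn => /GorbitP [g gG ->].
  by apply: nzchi_act => //; apply: Tchi_nz.
have [s sT hs] := reps_ex (nzchi_Htilde nz).
have sT' : s \in T by rewrite TchiE sT (nzchi_orbit _ hs) // reps_Htilde.
rewrite (bigD1 s) //= big1 ?addr0 => [|t /andP [tT ts]].
  case/GorbitP: hs => g gG ->; rewrite coefE ?Tchi_nz //.
  by case: cf => fG _; apply: fG => //; apply: Tchi_fix.
rewrite coef_eq0 ?rmorph0 ?mul0r //; apply: contra ts => ht.
have tH := Tchi_Htilde tT; have sH := reps_Htilde sT.
apply/eqP/reps_uniq; rewrite ?(Tchi_reps tT) //.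
rewrite -(Gorbit_eq mulA mulC ei tH ht) (Gorbit_eq mulA mulC ei sH hs).
exact: Gorbit_refl.
Qed.

(** This is [annihilating] read on representatives instead of orbits; [annihilatingP] relates the
    two. *)
Definition annih u := (u \in T) && [forall t in T, (t != e) ==> ~~ nzchi (u ** t)].

Lemma annihP u t : annih u -> t \in T -> t != e -> ~~ nzchi (u ** t).
Proof. by case/andP=> _ /forall_inP a tT te; have := a t tT; rewrite te. Qed.

(* If the form (s, t) |-> f (s t) is nondegenerate then f' = f (c -) for some c,
   and multiplication by c is triangular with the coordinate of c along the
   identity on the diagonal. *)
Lemma det_change_functional f f' u : chifun f -> chifun f' -> annih u ->
  sdet (enum T) (fun s t => f (s ** t)) != 0 ->
  sdet (enum T) (fun s t => f' (s ** t)) * f u ^+ #|T| =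
  sdet (enum T) (fun s t => f (s ** t)) * f' u ^+ #|T|.
Proof.
move=> cf cf' au; set D := sdet _ _ => D0.
(* Cramer's rule gives a [c] that represents [D * f'] rather than [f'], which avoids fractions. *)
have [c cE] := sdet_adj (fun s t => f (s ** t)) f' (enum_uniq T).
rewrite -/D in cE.
have uT : u \in T by case/andP: au.
have cEh h : h ** e = h -> D * f' h = \sum_(r <- enum T) c r * f (r ** h).
  move=> he; rewrite (chifun_expand cf' he) mulr_sumr.
  transitivity (\sum_(s <- enum T) \sum_(r <- enum T)
                  c r * (iota (coef s h) * f (s ** r))).
    apply: eq_big_seq => s sT; rewrite mulrCA -cE // mulr_sumr.
    by apply: eq_bigr => r _; rewrite mulrCA (mulC r).
  rewrite exchange_big /=; apply: eq_big_seq => r; rewrite mem_enum => rT.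
  rewrite (mulC r) -mulr_sumr; congr (_ * _).
  by rewrite (chifun_expand (chifun_shift (Tchi_fix rT) cf) he).
(* The matrix of multiplication by [c]. *)
pose L s w := \sum_(r <- enum T) c r * iota (coef w (r ** s)).
have DL : {in enum T &, forall s t,
    D * f' (s ** t) = \sum_(w <- enum T) L s w * f (w ** t)}.
  move=> s t; rewrite !mem_enum => sT tT.
  rewrite cEh; last by rewrite -mulA (Tchi_fix tT).
  under [RHS]eq_bigr => w _ do rewrite mulr_suml.
  rewrite exchange_big /=; apply: eq_big_seq => r; rewrite mem_enum => rT.
  rewrite mulA (chifun_expand (chifun_shift (Tchi_fix tT) cf)); last first.
    by rewrite -mulA (Tchi_fix sT).
  by rewrite mulr_sumr; apply: eq_bigr => w _; rewrite mulrA.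
have detL : sdet (enum T) L = c e ^+ #|T|.
  have Lnz s w : L s w != 0 -> exists2 r, r \in T & r ** s \in Gorbit mul e w.
    apply: contraNP => nr; apply/eqP; rewrite /L big1_seq // => r /andP [_].
    rewrite mem_enum => rT; rewrite coef_eq0 ?rmorph0 ?mulr0 //.
    by apply/negP => rs; apply: nr; exists r.
  (* The matrix is triangular for divisibility, which is antisymmetric on representatives: two that
     divide each other differ by a unit. *)
  rewrite (@sdet_triangular _ _ _ (fun s w => [exists a, w == s ** a])).
  - rewrite big_enum /= (eq_bigr (fun=> c e)) ?prodr_const // => s sT.
    rewrite /L big_enum /= (bigD1 e) ?Tchi1 //= coefE ?Tchi_nz //.
    rewrite (chi_one mulA mulC ei ch) rmorph1 mulr1 big1 ?addr0 // => r /andP [rT re].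
    (* If [r ** s] is in the orbit of [s], then [r] times a unit fixes [s], so [r] is a unit and its
       representative is [e]. *)
    rewrite coef_eq0 ?rmorph0 ?mulr0 //; apply: contra re => /GorbitP [g gG rs].
    have [h hG gh] := units_inv mulA mulC ei gG.
    have srh : s ** (r ** h) = s.
      by rewrite mulA (mulC s) rs smulAC // gh mulC Tchi_fix.
    apply/eqP/reps_unit; first exact: Tchi_reps.
    have he := units_fix mulA mulC ei hG.
    apply: (unit_factor (Tchi_fix rT) he).
    have := fixing_unit mulA mulC ei (Tchi_Htilde sT) srh.
    by rewrite mulC -mulA he.
  - exact: enum_uniq.
  - move=> y x z _ _ _ /existsP [a /eqP ->] /existsP [b /eqP ->].
    by apply/existsP; exists (a ** b); rewrite mulA.
  - move=> x y; rewrite !mem_enum => xT yT.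
    case/andP=> /existsP [a /eqP ya] /existsP [b /eqP xb].
    have xab : x ** (a ** b) = x by rewrite mulA -ya.
    have eab := fixing_unit mulA mulC ei (Tchi_Htilde xT) xab.
    have aG : e ** a \in G.
      have xe z : e ** z ** e = e ** z by rewrite smulAC // ee.
      by apply: (unit_factor (xe a) (xe b)); rewrite smulACA // ee.
    apply: reps_uniq; rewrite ?Tchi_reps //; apply/GorbitP; exists (e ** a) => //.
    by rewrite ya [RHS]mulC mulA (Tchi_fix xT).
  - move=> s w; rewrite !mem_enum => sT wT /Lnz [r rT /GorbitP [g gG rs]].
    have [h hG gh] := units_inv mulA mulC ei gG.
    apply/existsP; exists (r ** h); rewrite mulA (mulC s) rs.
    by rewrite smulAC // gh mulC Tchi_fix.
(* As [u] is annihilating, only the coordinate of [c] along the identity contributes. *)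
have Du : D * f' u = c e * f u.
  rewrite (cEh _ (Tchi_fix uT)) big_enum /= (bigD1 e) ?Tchi1 //=.
  rewrite big1 ?addr0 => [|r /andP [rT re]]; first by rewrite mulC (Tchi_fix uT).
  rewrite mulC (chifun_nz cf) ?mulr0 // ?(annihP au) //.
  by rewrite -mulA (Tchi_fix rT).
(* Scaling by [D] and factoring through [L] gives $D^n\det f'=c_e^nD$, with $n$ the size of $T$.
   Multiplying by $f(u)^n$, [Du] applies and $D^n$ cancels. *)
have := eq_sdet DL; rewrite sdet_scale sdet_mul -/D detL -cardE => E.
apply: (mulfI (expf_neq0 #|T| D0)).
by rewrite mulrA E mulrAC -exprMn -Du exprMn -mulrA (mulrC _ D).
Qed.

(** The functional [f] is compared with the coordinate along [u], whose value at [u] is 1. The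
    comparison is made in both directions, as each needs its starting determinant to be nonzero; if
    both vanish, the formula is trivial. *)
Lemma det_annih f u : chifun f -> annih u ->
  sdet (enum T) (fun s t => f (s ** t)) =
  iota (sdet (enum T) (fun s t => coef u (s ** t))) * f u ^+ #|T|.
Proof.
move=> cf au; have nzu : nzchi u by case/andP: au => /Tchi_nz.
have cc := chifun_coef nzu.
have u1 : iota (coef u u) = 1 by rewrite coef_self // rmorph1.
rewrite -sdet_rmorph.
have := det_change_functional cf cc au; have := det_change_functional cc cf au.
rewrite u1 expr1n !mulr1; set D := sdet _ _; set D' := sdet _ _ => B A.
have [D0|/B //] := eqVneq D 0; have [->|/A <- //] := eqVneq D' 0.
by rewrite D0 mul0r.
Qed.

Lemma det_two_annih f u v : chifun f -> annih u -> annih v -> u != v ->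
  sdet (enum T) (fun s t => f (s ** t)) = 0.
Proof.
move=> cf au av uv; have /andP [uT _] := au; have /andP [vT _] := av.
apply: (sdet_rows0 (e := e) (enum_uniq T) _ _ uv); rewrite ?mem_enum //.
move=> t; rewrite mem_enum => tT te.
have te' x : x ** t ** e = x ** t by rewrite -mulA (Tchi_fix tT).
by rewrite !(chifun_nz cf) ?(annihP au) ?(annihP av).
Qed.

(** Among the elements of [T], take [u] whose multiples are fewest. If [u ** t] were still nonzero,
    it would have the same multiples as [u], so some multiple of [t] would fix [u], making [t] a
    unit and hence [e]. *)
Lemma ex_annih : exists u, annih u.
Proof.
pose I u := [set u ** a | a in [set: S]].
case: (arg_minnP (fun u => #|I u|) Tchi1) => u.
rewrite -[_ u]/(u \in T) => uT umin; exists u.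
rewrite /annih uT; apply/forall_inP => t tT; apply/implyP; apply: contraNN => nz.
have tH := Tchi_Htilde tT; have te := Tchi_fix tT.
have [w wT /GorbitP [g gG ut]] := reps_ex (nzchi_Htilde nz).
have wH := reps_Htilde wT.
have wT' : w \in T.
  by rewrite TchiE wT (nzchi_orbit wH _ nz) //; apply/GorbitP; exists g.
have [h hG hu] := unit_actK mulA mulC ei gG wH.
have sub : I w \subset I u.
  apply/fintype.subsetP => _ /imsetP [a _ ->]; apply/imsetP.
  by exists (h ** t ** a); rewrite // mulA mulA (mulC u) -(mulA h) ut hu.
have : u \in I w.
  have /eqP -> : I w == I u by rewrite eqEcard sub umin.
  by apply/imsetP; exists e; rewrite // Tchi_fix.
case/imsetP => b _ ub.
have u_fix : u ** (t ** (h ** b)) = u.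
  by rewrite mulA ut mulA (mulC _ h) hu.
apply/eqP/reps_unit; first exact: Tchi_reps.
apply: (@unit_factor _ (e ** (h ** b))) => //; first by rewrite smulAC // ee.
have := fixing_unit mulA mulC ei (Tchi_Htilde uT) u_fix.
by rewrite smulCA.
Qed.

End OneChar.

(** * Change to the basis indexed by characters and representatives *)

Section AllChars.
Variable cs : seq {ffun S -> C}.
Hypotheses (csu : uniq cs) (csP : forall chi, (chi \in cs) <-> character chi).
Variable y : S -> K.

Let N : C := #|G|%:R.
Let N0 : N != 0.
Proof. by rewrite pnatr_eq0 -lt0n; apply/card_gt0P; exists e. Qed.

(* The functional y, extended by 0 at the zero of H^0, evaluated at h e_chi. *)
Definition ychi (chi : {ffun S -> C}) (h : S) : K :=
  if h \in H then
    iota N^-1 * \sum_(g in G) iota (Num.conj (chi g)) * y (g ** h)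
  else 0.

Lemma ychi_chifun chi : character chi -> chifun chi (ychi chi).
Proof.
move=> ch; split=> [g h gG he|h he /negbTE hH]; last by rewrite /ychi hH.
rewrite /ychi act_HtildeE //; case: ifP => hH; last by rewrite mulr0.
rewrite mulrCA; congr (_ * _); rewrite mulr_sumr.
rewrite -[RHS](sum_units_trans mulA mulC ei _ gG); apply: eq_bigr => x xG.
rewrite [RHS]mulrA -rmorphM.
have -> : chi g * Num.conj (chi (g ** x)) = Num.conj (chi x).
  rewrite (charM ch gG xG) rmorphM mulrA.
  by rewrite (char_norm mulA mulC ei ch gG) mul1r.
by rewrite mulA (mulC x).
Qed.

(** The idempotents attached to the characters sum to the identity: by orthogonality only [g = e]
    survives. *)
Lemma ychi_sum h : h ** e = h ->
  \sum_(chi <- cs) ychi chi h = if h \in H then y h else 0.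
Proof.
move=> he; rewrite /ychi; case: ifP => hH; last by rewrite big1.
rewrite -mulr_sumr exchange_big /= (bigD1 e) //= [X in _ + X]big1 ?addr0.
  rewrite -mulr_suml (mulC e) he -!rmorph_sum /= (sum_chars mulA mulC ei csu csP eG).
  by rewrite eqxx conjC_nat mulrA -rmorphM mulVf // rmorph1 mul1r.
move=> g /andP [gG /negbTE ge].
rewrite -mulr_suml -!rmorph_sum /= (sum_chars mulA mulC ei csu csP gG) ge.
by rewrite conjC0 rmorph0 mul0r.
Qed.

Definition charreps : seq ({ffun S -> C} * S) :=
  [seq (chi, s) | chi <- cs, s <- enum (Tchi mul e chi Tr)].

Lemma charrepsP chi s : reflect (character chi /\ s \in Tchi mul e chi Tr)
  ((chi, s) \in charreps).
Proof.
apply: (iffP allpairsPdep) => [[c [t [/csP cc tT [-> ->]]]]|[/csP cc sT]].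
  by split; [exact: cc|rewrite -mem_enum].
by exists chi, s; rewrite mem_enum.
Qed.

Lemma charreps_uniq : uniq charreps.
Proof.
apply: allpairs_uniq_dep => //; first by move=> chi _; apply: enum_uniq.
by move=> [c s] [d t] _ _ /= [-> ->].
Qed.

(** For [s != t] the supports are disjoint orbits. For [s = t] and [c != d], translation by a unit
    where [c] and [d] differ multiplies the sum by a scalar other than 1. Otherwise every term on
    the orbit is 1. *)
Lemma sum_coef_orth c s d t : (c, s) \in charreps -> (d, t) \in charreps ->
  \sum_(h <- enum H) Num.conj (coef c s h) * coef d t h =
  if (c, s) == (d, t) then #|Gorbit mul e s|%:R else 0.
Proof.
move=> /charrepsP [cc sT] /charrepsP [cd tT].
have sH := Tchi_Htilde sT; have tH := Tchi_Htilde tT.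
have nzs := Tchi_nz sT; have nzt := Tchi_nz tT.
rewrite xpair_eqE andbC; have [Est|st] := eqVneq s t; last first.
  rewrite big1 // => h _.
  have [hs|/(coef_eq0 c) ->] := boolP (h \in Gorbit mul e s);
    last by rewrite conjC0 mul0r.
  rewrite [coef d t h]coef_eq0 ?mulr0 //; apply: contra st => ht.
  apply/eqP/reps_uniq; rewrite ?(Tchi_reps sT) ?(Tchi_reps tT) //.
  rewrite -(Gorbit_eq mulA mulC ei sH hs) (Gorbit_eq mulA mulC ei tH ht).
  exact: Gorbit_refl.
rewrite -{t}Est in tT tH nzt *; rewrite big_enum /=.
pose F h := Num.conj (coef c s h) * coef d s h.
have [<-|cd'] := eqVneq c d.
  rewrite (bigID (mem (Gorbit mul e s))) /= [X in _ + X]big1 ?addr0; last first.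
    by move=> h /andP [_ hs]; rewrite [coef c s h]coef_eq0 // mulr0.
  rewrite (eq_bigr (fun=> 1)); last first.
    move=> h /andP [_ /GorbitP [g gG ->]].
    by rewrite !coefE // mulrC (char_norm mulA mulC ei cc).
  rewrite (eq_bigl (mem (Gorbit mul e s))) ?sumr_const // => h /=.
  by apply: andb_idl => /(Gorbit_sub mulA mulC ei sH).
have [g gG cdg] : exists2 g, g \in G & c g != d g.
  apply/exists_inP; apply: contraNT cd' => /exists_inPn cdE.
  apply/eqP/ffunP => g; have [gG|gN] := boolP (g \in G).
    by apply/eqP; have := cdE g gG; rewrite negbK.
  by rewrite (char0 cc) // (char0 cd).
have Fg h : h \in H -> F (g ** h) = Num.conj (c g) * d g * F h.
  move=> hH; have he := Htilde_fix hH.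
  by rewrite /F !coef_act // rmorphM mulrACA.
have E : \sum_(h in H) F h = \sum_(h in H) F (g ** h).
  have [k kG gk] := units_inv mulA mulC ei gG.
  have kG' h : h \in H -> g ** (k ** h) = h.
    by move=> hH; rewrite mulA gk mulC (Htilde_fix hH).
  have gK h : h ** e = h -> k ** (g ** h) = h.
    by move=> he; rewrite mulA (mulC k) gk mulC he.
  rewrite (reindex_onto (mul g) (mul k)) //=.
  apply: eq_bigl => h; apply/andP/idP => [[gh /eqP hE]|hH].
    have he : h ** e = h by rewrite -hE (mulC k) -mulA (units_fix mulA mulC ei kG).
    by rewrite -(act_HtildeE mulA mulC ei gG he).
  by rewrite act_Htilde // gK // Htilde_fix.
rewrite -/(F _) in E *; apply/eqP.
have : (1 - Num.conj (c g) * d g) * \sum_(h in H) F h = 0.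
  rewrite mulrBl mul1r {1}E mulr_sumr -sumrB big1 // => h hH.
  by rewrite Fg // subrr.
move/eqP; rewrite mulf_eq0 => /orP [|//]; rewrite subr_eq0 => /eqP cd1.
case/eqP: cdg; rewrite -[RHS]mul1r -(char_norm mulA mulC ei cc gG) -mulrA -cd1.
by rewrite mulr1.
Qed.

(** The characters trivial on the stabilizer of [s] are counted by summing all characters over the
    stabilizer in two ways. *)
Lemma card_nzchi s : s \in H ->
  \sum_(chi <- cs) (nzchi chi s)%:R = #|Gorbit mul e s|%:R :> C.
Proof.
move=> sH.
pose St := [set g in G | g ** s == s].
have St0 : #|St|%:R != 0 :> C.
  rewrite pnatr_eq0 -lt0n; apply/card_gt0P; exists e.
  by rewrite inE eG; apply/eqP; rewrite mulC Htilde_fix.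
have stab chi : character chi ->
    \sum_(g in G | g ** s == s) chi g = #|St|%:R * (nzchi chi s)%:R.
  move=> ch; have [nz|nn] := boolP (nzchi chi s).
    rewrite mulr1 (eq_bigr (fun=> 1)) => [|g /andP [gG /eqP gs]]; last first.
      by case/nzchiP: nz => _; apply.
    rewrite (eq_bigl (mem St)) ?sumr_const // => g.
    by rewrite -[RHS]/(g \in St) [RHS]inE.
  rewrite mulr0; move: nn; rewrite /nzchi sH /= => /forall_inPn [k kG].
  rewrite negb_imply => /andP [/eqP ks k1].
  pose F g := if g ** s == s then chi g else 0.
  have Fk g : g \in G -> F (k ** g) = chi k * F g.
    move=> gG; rewrite /F smulAC // ks (mulC s).
    by case: ifP; rewrite ?mulr0 ?(charM ch).
  rewrite big_mkcondr -/(F _); apply/eqP.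
  have : (1 - chi k) * \sum_(g in G) F g = 0.
    rewrite mulrBl mul1r -{1}(sum_units_trans mulA mulC ei F kG) mulr_sumr -sumrB.
    by rewrite big1 // => g gG; rewrite Fk // subrr.
  by move/eqP; rewrite mulf_eq0 subr_eq0 eq_sym (negbTE k1).
apply: (mulfI St0); rewrite mulr_sumr.
transitivity (\sum_(chi <- cs) \sum_(g in G | g ** s == s) chi g).
  by apply: eq_big_seq => chi /csP ch; rewrite stab.
rewrite exchange_big /= (bigD1 e) /=; last first.
  by rewrite eG; apply/eqP; rewrite mulC Htilde_fix.
rewrite [X in _ + X]big1 ?addr0; last first.
  move=> g /andP [/andP [gG _] /negbTE ge].
  by rewrite (sum_chars mulA mulC ei csu csP gG) ge.
rewrite (sum_chars mulA mulC ei csu csP eG) eqxx -natrM; congr _%:R.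
rewrite -sum1_card.
(* Orbit-stabilizer: every fibre of [g |-> g ** s] is a coset of the stabilizer. *)
rewrite (partition_big (fun g => g ** s) (mem (Gorbit mul e s))) /=; last first.
  by move=> g gG; apply/GorbitP; exists g.
rewrite mulnC -sum_nat_const; apply: eq_bigr => _ /GorbitP [k kG ->].
have [h hG hk] := unit_actK mulA mulC ei kG sH.
have [k' k'G kk'] := units_inv mulA mulC ei kG.
have kK g : g \in G -> k ** (k' ** g) = g.
  by move=> gG; rewrite mulA kk' mulC (units_fix mulA mulC ei gG).
have k'K g : g \in G -> k' ** (k ** g) = g.
  by move=> gG; rewrite mulA (mulC k') kk' mulC (units_fix mulA mulC ei gG).
rewrite (reindex_onto (mul k) (mul k')) /=; last by move=> g /andP [/kK].
have kC x : x ** e = x -> k' ** (k ** x) = x.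
  by move=> xe; rewrite mulA (mulC k') kk' mulC.
rewrite sum1_card; apply: eq_card => g; rewrite [RHS]inE.
apply/andP/andP => [[/andP [kg /eqP kgs] /eqP gE]|[gG /eqP gs]].
  have gG : g \in G by rewrite -gE; apply: unitsM.
  have : k' ** (k ** (g ** s)) = k' ** (k ** s) by rewrite [k ** (g ** s)]mulA kgs.
  rewrite !kC ?(Htilde_fix sH) // => [-> //|].
  by rewrite -mulA (Htilde_fix sH).
by rewrite unitsM // k'K // -mulA gs !eqxx.
Qed.

(** The transition matrix is square: by [card_nzchi], each representative occurs as often as its
    orbit has elements. *)
Lemma size_charreps : size charreps = #|H|.
Proof.
apply/eqP; rewrite -(eqr_nat C); apply/eqP.
rewrite size_allpairs_dep sumnE big_map natr_sum.
transitivity (\sum_(chi <- cs) \sum_(s in Tr) (nzchi chi s)%:R : C).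
  apply: eq_big_seq => chi /csP ch; rewrite -cardE -sum1_card natr_sum.
  rewrite (eq_bigl _ _ (TchiE chi)) big_mkcondr.
  by apply: eq_bigr => s _; case: (nzchi chi s).
rewrite exchange_big /= (eq_bigr (fun s => #|Gorbit mul e s|%:R)); last first.
  by move=> s sT; apply: card_nzchi; apply: reps_Htilde.
rewrite -natr_sum; congr _%:R.
rewrite -[RHS]sum1_card.
transitivity (\sum_(h in H) \sum_(s in Tr) (h \in Gorbit mul e s : nat)).
  rewrite exchange_big /=; apply: eq_bigr => s sT.
  rewrite -sum1_card big_mkcond [RHS]big_mkcond; apply: eq_bigr => h _.
  case: ifPn => hs; last by case: ifP.
  by rewrite (Gorbit_sub mulA mulC ei (reps_Htilde sT) hs).
apply: eq_bigr => h hH; have [s sT hs] := reps_ex hH.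
rewrite (bigD1 s) //= hs big1 // => t /andP [tT ts].
apply/eqP; rewrite eqb0; apply: contra ts => ht; apply/eqP/reps_uniq => //.
rewrite -(Gorbit_eq mulA mulC ei (reps_Htilde tT) ht).
by rewrite (Gorbit_eq mulA mulC ei (reps_Htilde sT) hs) Gorbit_refl // reps_Htilde.
Qed.

Lemma Tchi_conj (chi : {ffun S -> C}) : Tchi mul e (char_conj chi) Tr = Tchi mul e chi Tr.
Proof.
apply/setP => s; rewrite !TchiE; congr (_ && _); rewrite /nzchi; congr (_ && _).
apply: eq_forallb => g; rewrite ffunE.
by rewrite -(inj_eq (inv_inj conjCK)) conjCK conjC1.
Qed.

Lemma coef_conj (chi : {ffun S -> C}) w h :
  coef (char_conj chi) w h = Num.conj (coef chi w h).
Proof. by rewrite /coef; case: pickP => [g _|_]; rewrite ?ffunE ?conjC0. Qed.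

Let P (h : S) (j : {ffun S -> C} * S) : C := coef j.1 j.2 h.
(** An arbitrary bijection from [charreps] to [H], which lets one sequence index both rows and
    columns of the transition matrix. *)
Let phi j : S := nth e (enum H) (index j charreps).

Let map_phi : map phi charreps = enum H.
Proof.
apply: (@eq_from_nth _ e); first by rewrite size_map size_charreps cardE.
move=> i; rewrite size_map => ij.
have d : {ffun S -> C} * S by exact: ([ffun=> 0], e).
by rewrite (nth_map d) // /phi index_uniq // charreps_uniq.
Qed.

Let dP := sdet charreps (fun j k => P (phi j) k).

Lemma det_coef_sqr : exists b : bool,
  dP ^+ 2 = (-1) ^+ b * \prod_(j <- charreps) #|Gorbit mul e j.2|%:R.
Proof.
have pc : perm_eq [seq (char_conj j.1, j.2) | j <- charreps] charreps.
  have inj : injective (fun j : {ffun S -> C} * S => (char_conj j.1, j.2)).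
    move=> [c s] [d t] [/= cd ->]; congr (_, _).
    by apply: (inv_inj (@char_conjK _ _)).
  apply: uniq_perm; rewrite ?(map_inj_uniq inj) ?charreps_uniq //.
  move=> [c s]; apply/mapP/charrepsP => [[[d t] /charrepsP [cd tT] [-> ->]]|[cc sT]].
    by rewrite Tchi_conj; split=> //; apply: is_char_conj.
  exists (char_conj c, s); last by rewrite /= char_conjK.
  by apply/charrepsP; rewrite Tchi_conj; split=> //; apply: is_char_conj.
(* The sign is that of conjugation as a permutation of the columns. *)
have [b bE] := sdet_permcol C pc; exists b.
have orth : sdet charreps (fun j k => \sum_(l <- charreps)
      Num.conj (P (phi l) j) * P (phi l) k) =
    \prod_(j <- charreps) #|Gorbit mul e j.2|%:R.
  have PE : {in charreps &, forall j k, \sum_(l <- charreps)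
        Num.conj (P (phi l) j) * P (phi l) k =
      if j == k then #|Gorbit mul e j.2|%:R else 0}.
    move=> [c s] [d t] cs_ dt_; rewrite -(sum_coef_orth cs_ dt_) -map_phi big_map.
    by [].
  rewrite (eq_sdet PE) sdet_diag ?charreps_uniq //.
    by apply: eq_bigr => j _; rewrite eqxx.
  by move=> j k _ _ /negbTE ->.
rewrite -orth (sdet_mul _ (fun j l => Num.conj (P (phi l) j))).
rewrite (sdet_tr _ (fun l j => Num.conj (P (phi l) j))).
have -> : sdet charreps (fun j k => Num.conj (P (phi j) k)) = (-1) ^+ b * dP.
  rewrite /dP -bE; apply: eq_sdet => j k _ _; rewrite /P /=.
  by rewrite coef_conj.
by rewrite mulrA mulrA -signr_addb addbb mul1r expr2.
Qed.

(** In the new basis the form becomes $PMP^T$ with $M$ block diagonal over the characters;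
    [det_coef_sqr] evaluates $(\det P)^2$. *)
Lemma local_det : exists b : bool,
  sdet (enum H) (fun s t => if s ** t \in H then y (s ** t) else 0) =
  (-1) ^+ b * \prod_(chi <- cs)
    (iota (\prod_(s in Tchi mul e chi Tr) #|Gorbit mul e s|%:R) *
     sdet (enum (Tchi mul e chi Tr)) (fun s t => ychi chi (s ** t))).
Proof.
have [b bE] := det_coef_sqr; exists b.
(* The entries between distinct characters vanish because their idempotents are orthogonal. *)
pose M (j k : {ffun S -> C} * S) : K :=
  if j.1 == k.1 then ychi j.1 (j.2 ** k.2) else 0.
have YE s t : s \in H -> t \in H ->
    (if s ** t \in H then y (s ** t) else 0) =
    \sum_(j <- charreps) iota (P s j) *
      \sum_(k <- charreps) M j k * iota (P t k).
  move=> sH tH; rewrite -ychi_sum; last by rewrite -mulA (Htilde_fix tH).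
  rewrite /charreps big_allpairs_dep /=.
  apply: eq_big_seq => chi chics; have ch := (csP _).1 chics.
  have cy := ychi_chifun ch.
  rewrite (chifun_expand ch (chifun_shift (Htilde_fix tH) cy) (Htilde_fix sH)).
  apply: eq_big_seq => u; rewrite mem_enum => uT; congr (_ * _).
  rewrite big_allpairs_dep /= (bigD1_seq chi) //= [X in _ + X]big1_seq ?addr0; last first.
    move=> d /andP [dc _]; rewrite big1 // => v _.
    by rewrite /M /= eq_sym (negbTE dc) mul0r.
  rewrite mulC (chifun_expand ch (chifun_shift (Tchi_fix uT) cy) (Htilde_fix tH)).
  by apply: eq_bigr => v _; rewrite /M /= eqxx mulrC (mulC v).
have -> : sdet (enum H) (fun s t => if s ** t \in H then y (s ** t) else 0) =
    iota (dP ^+ 2) * sdet charreps M.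
  rewrite (eq_sdet (g := fun s t => \sum_(j <- charreps) iota (P s j) *
      \sum_(k <- charreps) M j k * iota (P t k))); last first.
    by move=> s t; rewrite !mem_enum; apply: YE.
  rewrite -map_phi sdet_map.
  rewrite (sdet_mul _ (fun j l => iota (P (phi j) l))).
  rewrite (sdet_mul _ M (fun k j => iota (P (phi j) k))).
  rewrite (sdet_tr _ (fun j k => iota (P (phi j) k))) (sdet_rmorph iota).
  by rewrite -/dP rmorphXn expr2 -mulrA [sdet _ _ * _]mulrC.
rewrite bE rmorphM rmorph_sign -mulrA; congr (_ * _).
have -> : \prod_(j <- charreps) #|Gorbit mul e j.2|%:R =
    \prod_(chi <- cs) \prod_(s in Tchi mul e chi Tr) #|Gorbit mul e s|%:R :> C.
  by rewrite /charreps big_allpairs_dep /=; apply: eq_bigr => chi _; rewrite big_enum.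
rewrite rmorph_prod big_split /=; congr (_ * _).
rewrite (_ : charreps = flatten [seq
  [seq (chi, s) | s <- enum (Tchi mul e chi Tr)] | chi <- cs]) //.
rewrite sdet_flatten //.
  apply: eq_bigr => chi _; rewrite sdet_map; apply: eq_sdet => s t _ _.
  by rewrite /M eqxx.
move=> c d x z _ _ cd /mapP [s _ ->] /mapP [t _ ->].
by rewrite /M (negbTE cd).
Qed.

End AllChars.
End Local.

(** * Annihilating elements of the orbit monoid *)

Section Annihilating.
Variables (S : finType) (mul : S -> S -> S).
Hypotheses (mulA : associative mul) (mulC : commutative mul).
Variable C : numClosedFieldType.
Local Notation "x ** y" := (mul x y) (at level 40, left associativity).
Variable e : S.
Hypothesis ei : e \in idem mul.
Local Notation G := (unitsG mul e).
Local Notation H := (Htilde mul e).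

(** The vanishing statement supplies no representatives, so some have to be chosen, with [e] imposed
    in its own orbit. *)
Lemma ex_reps : exists Tr, is_reps mul e Tr.
Proof.
have eH : e \in H by apply/(units_Htilde mulA mulC ei)/units1.
pose r (O : {set S}) := if e \in O then e else odflt e [pick x in O].
have rO s : s \in H -> r (Gorbit mul e s) \in Gorbit mul e s.
  move=> sH; rewrite /r; case: ifP => // _.
  by case: pickP => // /(_ s); rewrite Gorbit_refl.
exists [set r O | O in [set Gorbit mul e s | s in H]].
split; last first.
  apply/imsetP; exists (Gorbit mul e e); first exact: imset_f.
  by rewrite /r Gorbit_refl.
apply/and3P; split.
- apply/and3P; split.
  + rewrite finset.eqEsubset; apply/andP; split; apply/fintype.subsetP => x.
      by case/bigcupP => _ /imsetP [s sH ->]; apply: (Gorbit_sub mulA mulC ei).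
    move=> xH; apply/bigcupP; exists (Gorbit mul e x); first exact: imset_f.
    exact: Gorbit_refl.
  + apply/finset.trivIsetP => _ _ /imsetP [s sH ->] /imsetP [t tH ->].
    apply: contraR; rewrite -finset.setI_eq0 => /set0Pn [x /setIP [xs xt]].
    by rewrite -(Gorbit_eq mulA mulC ei sH xs) (Gorbit_eq mulA mulC ei tH xt).
  + apply/negP => /imsetP [s sH s0].
    by have := Gorbit_refl mulA mulC ei sH; rewrite -s0 inE.
- apply/fintype.subsetP => _ /imsetP [_ /imsetP [s sH ->] ->].
  by apply: (Gorbit_sub mulA mulC ei sH); apply: rO.
- apply/forall_inP => _ /imsetP [s sH ->]; apply/cards1P; exists (r (Gorbit mul e s)).
  apply/setP => x; rewrite finset.in_setI finset.in_set1; apply/andP/eqP => [[]|->];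
    last first.
    by split; [apply/imset_f/imset_f|exact: rO].
  case/imsetP => _ /imsetP [t tH ->] -> rs.
  rewrite -(Gorbit_eq mulA mulC ei tH (rO t tH)).
  by rewrite (Gorbit_eq mulA mulC ei sH rs).
Qed.

Variable Tr : {set S}.
Hypothesis repsT : is_reps mul e Tr.
Variable chi : {ffun S -> C}.
Hypothesis ch : is_char mul e chi.
Local Notation T := (Tchi mul e chi Tr).
Local Notation nz := (nzchi mul e chi).
Local Notation orb m := (rorbit mul e chi m).

Lemma mem_imset_Some (A : {set S}) x :
  (Some x \in [set Some y | y in A]) = (x \in A).
Proof. by apply: mem_imset => a b []. Qed.

Lemma Ichi_Some h : (Some h \in Ichi mul e chi) = (h \in H) && ~~ nz h.
Proof.
rewrite [LHS]inE [_ \in H0 _ _]inE [Some h \in [set None]]inE /=.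
rewrite mem_imset_Some.
by have [hH|//] := boolP (h \in H); rewrite stabE.
Qed.

Lemma mulR_Some a b :
  mulR mul e chi (Some a) (Some b) = if nz (a ** b) then Some (a ** b) else None.
Proof.
rewrite /mulR /mulH; have [abH|abN] := boolP (a ** b \in H).
  by rewrite Ichi_Some abH /=; case: (nz _).
by rewrite if_same /nzchi (negbTE abN).
Qed.

Lemma mulR_None a b : a = None \/ b = None -> mulR mul e chi a b = None.
Proof.
by rewrite /mulR /mulH; case: a b => [a|] [b|] []; rewrite // if_same.
Qed.

Lemma rorbit_None : orb None = [set None].
Proof.
apply/setP => x; rewrite finset.in_set1; apply/imsetP/eqP => [[g _ ->]|->].
  by rewrite mulR_None; [|right].
by exists e; [exact: units1|rewrite mulR_None; [|right]].
Qed.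

Lemma rorbit_Some s : nz s -> orb (Some s) = [set Some x | x in Gorbit mul e s].
Proof.
move=> ns; apply/setP => x; apply/imsetP/imsetP.
  move=> [g gG ->]; exists (g ** s); first by apply/GorbitP; exists g.
  by rewrite mulR_Some nzchi_act.
move=> [_ /GorbitP [g gG ->] ->]; exists g => //.
by rewrite mulR_Some nzchi_act.
Qed.

Lemma orbmonP X : reflect (X = [set None] \/ exists2 t, t \in T & X = orb (Some t))
  (X \in orbmon mul e chi).
Proof.
apply: (iffP imsetP) => [[m]|].
  rewrite inE => /orP [/set1P ->|]; first by move=> ->; left; apply: rorbit_None.
  rewrite inE => /andP [mI mH]; case: m mI mH => [s|] mI; last first.
    by move=> _ ->; rewrite rorbit_None; left.
  rewrite inE finset.in_set1 /= mem_imset_Some.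
  move=> sH -> ; right.
  have ns : nz s by move: mI; rewrite Ichi_Some sH negbK.
  have [t tT ts] := reps_ex mulA mulC ei repsT sH.
  have tH := reps_Htilde repsT tT.
  have nt := nzchi_orbit mulA mulC ei tH ts ns.
  exists t; first by rewrite (TchiE mulA mulC ei repsT) tT.
  by rewrite !rorbit_Some // (Gorbit_eq mulA mulC ei tH ts).
case=> [->|[t tT ->]].
  by exists None; rewrite ?rorbit_None // inE finset.in_set1 eqxx.
have nt := Tchi_nz mulA mulC ei repsT tT; have tH := nzchi_Htilde nt.
exists (Some t) => //; rewrite inE; apply/orP; right.
rewrite inE Ichi_Some tH nt /= inE; apply/orP; right.
by rewrite mem_imset_Some.
Qed.

Lemma rorbit_inj s t : s \in T -> t \in T -> orb (Some s) = orb (Some t) -> s = t.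
Proof.
move=> sT tT; have ns := Tchi_nz mulA mulC ei repsT sT.
have nt := Tchi_nz mulA mulC ei repsT tT.
rewrite !rorbit_Some // => /setP /(_ (Some t)).
rewrite !mem_imset_Some (Gorbit_refl mulA mulC ei (nzchi_Htilde nt)) => ts.
have TR := Tchi_reps mulA mulC ei repsT.
exact: (reps_uniq mulA mulC ei repsT (TR _ _ _ sT) (TR _ _ _ tT) ts).
Qed.

Lemma rorbit_Some_neq0 s : nz s -> orb (Some s) != [set None].
Proof.
move=> ns; apply/eqP => /setP /(_ (Some s)).
rewrite rorbit_Some // mem_imset_Some.
by rewrite (Gorbit_refl mulA mulC ei (nzchi_Htilde ns)) finset.in_set1.
Qed.

Lemma mulO_eq0 s t : nz s -> nz t ->
  (mulO mul e chi (orb (Some s)) (orb (Some t)) == [set None]) = ~~ nz (s ** t).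
Proof.
move=> ns nt; rewrite !rorbit_Some //.
have so x : nz x -> Some x \in [set Some x | x in Gorbit mul e x].
  move=> nx; apply: imset_f.
  exact: (Gorbit_refl mulA mulC ei (nzchi_Htilde nx)).
have [nst|nst] := boolP (nz (s ** t)).
  apply/eqP => /setP /(_ (Some (s ** t))).
  rewrite finset.in_set1 => /negbT /negP; apply.
  by apply/imset2P; exists (Some s) (Some t); rewrite ?so // mulR_Some nst.
apply/eqP/setP => x; rewrite finset.in_set1; apply/imset2P/eqP => [|->].
  move=> [_ _ /imsetP [_ /GorbitP [g gG ->] ->] /imsetP [_ /GorbitP [h hG ->] ->] ->].
  rewrite mulR_Some; case: ifP => // ngh; case/negP: nst; move: ngh.
  rewrite smulACA // => ngh.
  have stH : s ** t \in H.
    rewrite -(act_HtildeE mulA mulC ei (unitsM mulA mulC ei gG hG)).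
      exact: nzchi_Htilde ngh.
    by rewrite -mulA (Htilde_fix (nzchi_Htilde nt)).
  apply: (nzchi_orbit mulA mulC ei stH _ ngh).
  by apply/GorbitP; exists (g ** h); rewrite ?unitsM.
by exists (Some s) (Some t); rewrite ?so // mulR_Some (negbTE nst).
Qed.

(** Nonzero orbits correspond to elements of [T], and [mulO_eq0] turns vanishing products of orbits
    into a condition on representatives. *)
Lemma annihilatingP X : reflect
  (exists2 u, annih mul e Tr chi u & X = orb (Some u)) (annihilating mul e chi X).
Proof.
have e1 := Tchi1 mulA mulC ei repsT ch.
apply: (iffP and3P) => [[/orbmonP [->|[u uT ->]]]|[u au ->]].
- by rewrite rorbit_None eqxx.
- move=> _ /forall_inP ann; exists u => //; rewrite /annih uT.
  apply/forall_inP => t tT; apply/implyP => te.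
  have nu := Tchi_nz mulA mulC ei repsT uT; have nt := Tchi_nz mulA mulC ei repsT tT.
  rewrite -mulO_eq0 // -rorbit_None.
  have tO : orb (Some t) \in orbmon mul e chi by apply/orbmonP; right; exists t.
  by apply: (implyP (ann _ tO)); apply: contraNneq te => /(rorbit_inj tT e1) ->.
have /andP [uT _] := au; have nu := Tchi_nz mulA mulC ei repsT uT.
split; first by apply/orbmonP; right; exists u.
  by rewrite rorbit_None rorbit_Some_neq0.
apply/forall_inP => _ /orbmonP [->|[t tT ->]]; apply/implyP => ne; last first.
  have nt := Tchi_nz mulA mulC ei repsT tT.
  rewrite rorbit_None mulO_eq0 //; apply: (annihP au) => //.
  by apply: contraNneq ne => ->.
rewrite rorbit_None; apply/eqP/setP => x; rewrite finset.in_set1.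
apply/imset2P/eqP => [[a b _ /set1P -> ->]|->]; first by rewrite mulR_None //; right.
exists (Some u) None; rewrite ?finset.in_set1 //; last by rewrite mulR_None //; right.
rewrite rorbit_Some //; apply: imset_f.
exact: (Gorbit_refl mulA mulC ei (nzchi_Htilde nu)).
Qed.

(** Existence always holds by [ex_annih], so only uniqueness can fail. *)
Lemma not_uniq_annih : ~ (exists! X, annihilating mul e chi X) ->
  exists u v, [/\ annih mul e Tr chi u, annih mul e Tr chi v & u != v].
Proof.
move=> nX; have [u au] := ex_annih mulA mulC ei repsT ch.
have [/existsP [v /andP [av uv]]|/existsPn all] :=
    boolP [exists v, annih mul e Tr chi v && (u != v)].
  by exists u, v.
case: nX; exists (orb (Some u)); split; first by apply/annihilatingP; exists u.
move=> _ /annihilatingP [v av ->].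
by have := all v; rewrite av negbK => /eqP ->.
Qed.

End Annihilating.

(** * The determinant formula *)

Lemma prod_sign (R : pzRingType) (I : finType) (P : pred I) (F E : I -> R) :
  (forall i, P i -> exists b : bool, F i = (-1) ^+ b * E i) ->
  exists b : bool, \prod_(i | P i) F i = (-1) ^+ b * \prod_(i | P i) E i.
Proof.
move=> FE; apply: (big_ind2 (fun x y => exists b : bool, x = (-1) ^+ b * y)) => //.
  by exists false; rewrite mul1r.
move=> x1 x2 y1 y2 [a ->] [b ->]; exists (a (+) b).
by rewrite signr_addb -!mulrA; congr (_ * _); rewrite !mulrA commr_sign.
Qed.

(* If D = sgdet is nonzero then D x = x(c -) for some c, hence c t = D t for all
   t by nondegeneracy, and every t lies in S^2. *)
Lemma sgdet_square (S : finType) (mul : S -> S -> S) (C : numClosedFieldType) :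
  associative mul -> square mul <> [set: S] -> sgdet mul C = 0.
Proof.
move=> mulA SS; pose f s t := xvar C (mul s t).
have -> : sgdet mul C = sdet (enum S) f by apply: (sdet_enum S f).
apply/eqP; apply: contra_notT SS => D0.
apply/setP => u; rewrite [RHS]inE; apply: contraNT D0 => uN.
have [c cE] := sdet_adj f (xvar C) (enum_uniq S).
set D := sdet _ _ in cE *; apply/eqP.
(* The coordinates of $cu-Du$, which lies in the kernel of the form. *)
pose w x := \sum_(s <- enum S) c s * (x == mul s u)%:R - D * (x == u)%:R.
have [//|D0] := eqVneq D 0.
have w0 : {in enum S, forall y, \sum_(x <- enum S) w x * f x y = 0}.
  move=> y _; under eq_bigr => x _ do rewrite /w mulrBl mulr_suml.
  rewrite sumrB exchange_big /= big_enum /= [X in _ - X]big_enum /=.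
  rewrite [X in _ - X](bigD1 u) //= [X in _ - (_ + X)]big1 ?addr0; last first.
    by move=> x /negbTE ->; rewrite mulr0 mul0r.
  rewrite eqxx mulr1 /f -cE ?mem_enum // big_enum /=.
  apply/eqP; rewrite subr_eq0; apply/eqP; apply: eq_bigr => s _.
  rewrite big_enum /= (bigD1 (mul s u)) //= big1 ?addr0; last first.
    by move=> x /negbTE ->; rewrite mulr0 mul0r.
  by rewrite eqxx mulr1 /f mulA.
(* Since [u] is not a product, $cu$ has no coordinate along [u], and the coordinate of the whole is
   $-D$. *)
have := sdet_ker D0 w0; move=> /(_ u); rewrite mem_enum => /(_ isT).
rewrite /w eqxx mulr1 big1_seq ?sub0r => [/eqP|s _]; first by rewrite oppr_eq0 => /eqP.
case: eqP => [us|_]; last by rewrite mulr0.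
by case/negP: uN; rewrite us; apply: imset2_f; rewrite inE.
Qed.

Theorem theorem6p14 (R : realType) (S : finType) (mul : S -> S -> S)
    (mulA : associative mul) (mulC : commutative mul) :
  (square mul <> [set: S] -> sgdet mul R[i] = 0) /\
  (square mul = [set: S] ->
     ((exists (e : S) (chi : {ffun S -> R[i]}),
         [/\ e \in idem mul, charG mul e chi
           & ~ (exists! X, annihilating mul e chi X)]) ->
      sgdet mul R[i] = 0) /\
     ((forall (e : S) (chi : {ffun S -> R[i]}),
         e \in idem mul -> charG mul e chi ->
         exists! X, annihilating mul e chi X) ->
      forall T : S -> {set S},
        (forall e, e \in idem mul -> is_reps mul e (T e)) ->
        exists sc : S -> {ffun S -> R[i]} -> S,
          (forall e chi, e \in idem mul -> charG mul e chi ->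
             is_schi mul e chi (T e) (sc e chi)) /\
          exists b : bool,
            sgdet mul R[i] =
            (-1) ^+ b *
            \prod_(e in idem mul)
              \big[*%R/1]_(chi \in charG mul e)
                (((\prod_(s in Tchi mul e chi (T e))
                     (#|Gorbit mul e s|%:R / #|unitsG mul e|%:R))
                  * \det (Amatrix mul e chi (T e) (sc e chi)))%:MP
                 * (\sum_(g in unitsG mul e)
                      Num.conj (chi g) *:
                      \sum_(t | sle mul t (mul g (sc e chi)))
                        moebius mul R[i] t (mul g (sc e chi)) *:
                        xvar R[i] t)
                   ^+ #|Tchi mul e chi (T e)|))).
Proof.
split; first exact: sgdet_square.
move=> SS; pose C : numClosedFieldType := R[i].
pose iota : {rmorphism C -> {mpoly C[#|S|]}} := @mpolyC #|S| C.
pose y := yvar mul C.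
split.
  move=> [e [chi [ei ch nX]]].
  have [Tr repsT] := ex_reps mulA mulC ei.
  have [u [v [au av uv]]] := not_uniq_annih mulA mulC ei repsT ch nX.
  have [cs [csu csP]] := finite_chars mulA mulC C ei.
  rewrite sgdet_blocks // (bigD1 e) //=.
  have [b ->] := local_det mulA mulC ei repsT iota csu csP y.
  rewrite (bigD1_seq chi) //=; last exact/csP.
  have cy := ychi_chifun mulA mulC ei iota y ch.
  rewrite (det_two_annih mulA mulC ei repsT cy au av uv).
  by rewrite !(mulr0, mul0r).
move=> _ T Treps.
(* The default [e] is never reached for a character of an idempotent, by [ex_annih]. *)
pose sc e (chi : {ffun S -> C}) := odflt e [pick u | annih mul e (T e) chi u].
have scP e chi : e \in idem mul -> charG mul e chi ->
    annih mul e (T e) chi (sc e chi).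
  move=> ei ch; rewrite /sc; case: pickP => // nu.
  by have [u] := ex_annih mulA mulC ei (Treps e ei) ch; rewrite nu.
exists sc; split=> [e chi ei ch|].
  have au := scP e chi ei ch; split; first by case/andP: au.
  by apply/(annihilatingP mulA mulC ei (Treps e ei) ch); exists (sc e chi).
rewrite sgdet_blocks //; apply: prod_sign => e ei.
have [cs [csu csP]] := finite_chars mulA mulC C ei.
(* Listing the set of characters turns the product over a classical set into one over [cs]. *)
have -> : charG mul e = [set` cs]%classic.
  by apply/seteqP; split=> chi /csP.
rewrite -fsbig_seq //.
have [b ->] := local_det mulA mulC ei (Treps e ei) iota csu csP y.
exists b; congr (_ * _); apply: eq_big_seq => chi /csP ch.
set u := sc e chi.
have au : annih mul e (T e) chi u by apply: scP.
have cy := ychi_chifun mulA mulC ei iota y ch.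
rewrite (det_annih mulA mulC ei (Treps e ei) ch cy au).
have uH : u \in Htilde mul e.
  by case/andP: au => /(Tchi_Htilde mulA mulC ei (Treps e ei)).
rewrite -(sdet_enum _ (fun s t => coef mul e chi u (mul s t))).
(* The factor $1/|G_e|$ in [ychi], raised to the size of [Tchi], supplies the denominators of the
   factors $|G_es|/|G_e|$. *)
rewrite /ychi uH exprMn !mulrA; congr (_ * _).
  rewrite big_split /= prodr_const rmorphM rmorphM rmorphXn /=.
  by rewrite mulrAC.
congr (_ ^+ _); apply: eq_bigr => g _.
by rewrite -mul_mpolyC.
Qed.
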